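(* Let $\Gamma$ be a countable amenable group that acts (on the left) by homeomorphisms on two compact metric spaces $X$ and $Y$, and let $\pi: X \to Y$ be a continuous surjective $\Gamma$-equivariant map. If there exists a $\Gamma$-invariant Borel probability measure $\nu$ on the space $\mathrm{Ord}(\Gamma)$ of partial orders on $\Gamma$ such that the action of $\Gamma$ on $X$ is $\nu$-topologically predictable relative to $\pi: X \to Y$, then the topological entropy of the action of $\Gamma$ on $X$ is equal to the topological entropy of the action of $\Gamma$ on $Y$.
   Context: A partial order on $\Gamma$ is a binary relation $\prec$ on $\Gamma$ that is antisymmetric in the strict sense ($x \prec y$ implies $y \not\prec x$) and transitive. $\mathrm{Ord}(\Gamma)\subset 2^{\Gamma\times\Gamma}$ is the set of all partial orders on $\Gamma$, a closed subset of the compact metrizable space $2^{\Gamma \times \Gamma}$ of binary relations (product topology). $\Gamma$ acts on the left on $2^{\Gamma\times\Gamma}$, preserving $\mathrm{Ord}(\Gamma)$, by $x\,(g\cdot R)\,y \Leftrightarrow (xg)\,R\,(yg)$ for $x,y,g\in\Gamma$. For a $\Gamma$-invariant Borel probability measure $\nu$ on $\mathrm{Ord}(\Gamma)$, the action of $\Gamma$ on $X$ is $\nu$-topologically predictable relative to $\pi:X\to Y$ if for every $f \in C(X)$ and for $\nu$-a.e. $\prec\,\in \mathrm{Ord}(\Gamma)$, the function $f$ is contained in the closed algebra generated by $\{f\circ g : g\in\Gamma,\ g \prec 1_\Gamma\}$ together with the image of $C(Y)$ in $C(X)$ under $\pi_*: h \mapsto h\circ\pi$. Here $C(X)$ is the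 Banach algebra of continuous real-valued functions with the supremum norm, and $f\circ g$ is the function $x\mapsto f(gx)$. *)

(* Defs.v *)
From HB Require Import structures.
From mathcomp Require Import all_boot all_order all_algebra finmap.
From mathcomp Require Import all_classical all_reals all_analysis.

Set Implicit Arguments.
Unset Strict Implicit.
Unset Printing Implicit Defensive.

Import Order.TTheory GRing.Theory Num.Theory.
Import numFieldTopology.Exports numFieldNormedType.Exports.

Local Open Scope classical_set_scope.
Local Open Scope ring_scope.

Section Orders.
Variable G : groupType.

Definition porders : set {ptws G * G -> bool} :=
  [set r : G * G -> bool |
           (forall x y, r (x, y) -> ~~ r (y, x)) /\
           (forall x y z, r (x, y) -> r (y, z) -> r (x, z))].

(* Ord(G), with the subspace topology inherited from 2^(G x G). *)
Definition Ord : Type := porders.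

HB.instance Definition _ := Topological.on Ord.

Definition prec (r : Ord) (x y : G) : bool := (\val r : G * G -> bool) (x, y).

Lemma porders_empty : (fun=> false) \in porders.
Proof. by rewrite inE; split. Qed.

(* measurable types must be pointed: the base point is the empty order *)
HB.instance Definition _ :=
  isPointed.Build Ord (exist (fun r => r \in porders) _ porders_empty).

Lemma porders_translate (g : G) (r : Ord) :
  (fun p : G * G => prec r (p.1 * g)%g (p.2 * g)%g) \in porders.
Proof.
have [rA rT] := set_valP r.
rewrite inE; split=> [x y | x y z]; [exact: rA | exact: rT].
Qed.

Definition Ord_act (g : G) (r : Ord) : Ord :=
  exist (fun r => r \in porders) _ (porders_translate g r).

Definition borelOrd := g_sigma_algebraType (@open Ord).

Definition Ord_invariant (R : realType) (nu : probability borelOrd R) :=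
  forall (g : G) (A : set borelOrd),
    measurable A -> nu (Ord_act g @^-1` A) = nu A.

End Orders.

Section Amenability.
Variables (R : realType) (G : groupType).

(* Left Folner sequences, which are the ones matching the refinements
   of covers by the sets g^-1 U, g \in F, used in [join_cover]. *)
Definition folner (F : nat -> {fset G}) :=
  (forall n, F n != fset0) /\
  forall g : G,
    (fun n => let gF := [fset (g * x)%g | x in F n]%fset in
       #|` ((gF `\` F n) `|` (F n `\` gF))%fset |%:R / #|` F n|%:R : R)
    @ \oo --> (0 : R).

(* For countable groups. *)
Definition amenable := exists F, folner F.

End Amenability.

(* Continuity of all the maps [a g] makes them homeomorphisms, the inverse
   of [a g] being [a g^-1]. *)
Definition continuous_action (G : groupType) (X : topologicalType)
    (a : G -> X -> X) :=
  [/\ forall x, a 1%g x = x,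
      forall g h x, a (g * h)%g x = a g (a h x) &
      forall g, continuous (a g)].

Section Entropy.
Variables (R : realType) (G : groupType) (X : topologicalType).
Variables (a : G -> X -> X) (F : nat -> {fset G}).

Definition open_cover (U : set (set X)) :=
  (forall A, U A -> open A) /\ \bigcup_(A in U) A = [set: X].

Definition has_subcover (U : set (set X)) (n : nat) :=
  exists V : set (set X),
    [/\ V `<=` U, (V #= `I_n)%card & \bigcup_(A in V) A = [set: X]].

(* Least cardinality of a subcover; the default value 0 is irrelevant for
   open covers of compact spaces. *)
Definition covering_number (U : set (set X)) : nat :=
  xget 0%N [set n | has_subcover U n /\
                    forall m, has_subcover U m -> (n <= m)%N].

(* The common refinement of the covers a(g)^-1 U, g \in K. *)
Definition join_cover (U : set (set X)) (K : {fset G}) : set (set X) :=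
  [set \bigcap_(g in [set` K]) (a g @^-1` u g)
     | u in [set u : G -> set X | forall g, g \in K -> U (u g)]].

(* When F is a Folner sequence this limsup is a limit, which does not depend
   on F (Ornstein-Weiss). *)
Definition cover_entropy (U : set (set X)) : \bar R :=
  limn_esup (fun n => (ln (covering_number (join_cover U (F n)))%:R
                        / #|` F n|%:R)%:E).

Definition topological_entropy : \bar R :=
  ereal_sup [set cover_entropy U | U in open_cover].

End Entropy.

Section Predictability.
Variables (R : realType) (G : groupType).

(* Closed subalgebras of C(X): as C(X) is closed among all functions for
   uniform convergence, the closure may be taken in {uniform X -> R}. *)
Definition closed_subalgebra (X : topologicalType) (A : set (X -> R)) :=
  [/\ A `<=` [set f | continuous f],
      closed (A : set {uniform X -> R}),
      A (cst 0) &
      [/\ forall f g, A f -> A g -> A (f \+ g),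
          forall f g, A f -> A g -> A (f \* g) &
          forall (c : R) f, A f -> A (fun x => c * f x)]].

Definition predictable (nu : probability (borelOrd G) R)
    (X Y : topologicalType) (a : G -> X -> X) (p : X -> Y) :=
  forall f : X -> R, continuous f ->
    {ae nu, forall r : Ord G,
      smallest (@closed_subalgebra X)
        ([set f \o a g | g in [set g | prec r g 1%g]] `|`
         [set h \o p | h in [set h : Y -> R | continuous h]]) f}.

End Predictability.

(* Main.v *)
(** The inequality h(Y) <= h(X) holds because covers of Y pull back to covers
    of X. For the converse it suffices to show, for every continuous f on X,
    that along a large Folner set F the Y-orbit of x up to some delta leaves at
    most e^(kappa |F|) itineraries of x for the cover {f > 0}, {f < 1}.
    Averaging over the random order gives, for each F, a fixed order r such
    that, for most g in F, f(g x) is a function of the Y-orbit of x and of the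
    values f(h x) with h below g. A prediction of finite precision is only of
    use if errors do not accumulate along r, so f is first composed with a
    devil's staircase phi, going from 0 to 1 on [0, 1] and taking dyadic values
    outside small windows. If the orbit of x along F rarely visits the windows,
    then knowing phi(f(g x)) up to 1/2 determines it exactly for most g, and
    the other g contribute a factor e^(kappa |F|). The staircase depends on x:
    its windows at each level are picked by the pigeonhole principle in a
    finite family of disjoint ones. If the bound failed, it would fail along an
    infinite branch of choices; but predictability, applied to the staircase of
    that branch, only involves finitely many of its levels, which proves the
    bound for some finite stage of the branch. The constants lost at each
    choice are harmless when G is infinite; when G is finite, r has a minimal
    element, so that f is predicted by Y alone. *)

Require Import Defs.
From HB Require Import structures.
From mathcomp Require Import all_boot all_order all_algebra finmap.
From mathcomp Require Import all_classical all_reals all_analysis.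
From mathcomp Require Import measurable_realfun ring lra.

Set Implicit Arguments.
Unset Strict Implicit.
Unset Printing Implicit Defensive.

Import Order.TTheory GRing.Theory Num.Theory.
Import numFieldTopology.Exports numFieldNormedType.Exports.

Local Open Scope classical_set_scope.
Local Open Scope ring_scope.

(** * Devil's staircases *)

Lemma exists_half_expr_lt {R : realType} (e : R) : 0 < e ->
  exists i, 2^-1 ^+ i < e.
Proof.
move=> e0; have h : `|2^-1 : R| < 1 by rewrite ger0_norm; lra.
have /cvgrPdist_lt/(_ e e0)[i _ /(_ i (leqnn i))] := cvg_expr h.
rewrite /= sub0r normrN => lt_e; exists i.
by apply: le_lt_trans lt_e; exact: ler_norm.
Qed.

Section Staircase.
Context {R : realType}.
Variables (M : nat -> nat).
Implicit Types (c : nat -> nat) (i j k : nat) (t : R).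

Definition clamp t : R := Num.max 0 (Num.min 1 t).

(* The unit interval of level [j] is cut into [2 * M j] intervals; the [c j]-th
   and the [(M j + c j)]-th carry half-size copies of the staircase of level
   [j.+1], and the staircase is constant on the others. After [k] levels, the
   copies are replaced by the identity. *)
Fixpoint stair c k j t : R :=
  if k is k'.+1 then
    (stair c k' j.+1 ((M j).*2%:R * t - (c j)%:R) +
     stair c k' j.+1 ((M j).*2%:R * t - (M j)%:R - (c j)%:R)) / 2
  else clamp t.

(** The union of the [2 ^ i] open intervals carrying the copies that remain after [i] levels; only
    there do further levels change the staircase. *)
Fixpoint window c i j t : bool :=
  if i is i'.+1 then
    window c i' j.+1 ((M j).*2%:R * t - (c j)%:R) ||
    window c i' j.+1 ((M j).*2%:R * t - (M j)%:R - (c j)%:R)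
  else 0 < t < 1.

Lemma windowS_or c i j t : window c i.+1 j t =
  window c i j.+1 ((M j).*2%:R * t - (c j)%:R) ||
  window c i j.+1 ((M j).*2%:R * t - (M j)%:R - (c j)%:R).
Proof. by []. Qed.

Section Branch.
Variable c : nat -> nat.
Hypothesis c_lt : forall j, (c j < M j)%N.

Let cM j : (c j)%:R + 1 <= (M j)%:R :> R.
Proof. by rewrite natr1 ler_nat. Qed.

Let c0 j : 0 <= (c j)%:R :> R.
Proof. exact: ler0n. Qed.

Let M2 j : (M j).*2%:R = (M j)%:R + (M j)%:R :> R.
Proof. by rewrite -addnn natrD. Qed.

Lemma clamp_le0 t : t <= 0 -> clamp t = 0.
Proof.
by move=> t0; rewrite /clamp; apply/max_idPl; rewrite ge_min t0 orbT.
Qed.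

Lemma clamp_ge1 t : 1 <= t -> clamp t = 1.
Proof.
by move=> t1; rewrite /clamp (min_idPl t1); apply/max_idPr; exact: ler01.
Qed.

Lemma stair_le0 k j t : t <= 0 -> stair c k j t = 0.
Proof.
elim: k j t => [|k IH] j t t0 /=; first exact: clamp_le0.
have h := cM j; have h0 := c0 j.
have {t0} s0 : (M j).*2%:R * t <= 0.
  by rewrite pmulr_rle0 // ltr0n double_gt0 (leq_ltn_trans _ (c_lt j)).
rewrite !IH; lra.
Qed.

Lemma stair_ge1 k j t : 1 <= t -> stair c k j t = 1.
Proof.
elim: k j t => [|k IH] j t t1 /=; first exact: clamp_ge1.
have h := cM j; have h0 := c0 j; have m2 := M2 j.
have {t1} s0 : (M j).*2%:R <= (M j).*2%:R * t by rewrite ler_peMr // ler0n.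
rewrite !IH; lra.
Qed.

Lemma stair_ge0_le1 k j t : 0 <= stair c k j t <= 1.
Proof.
elim: k j t => [|k IH] j t /=.
  by rewrite /clamp le_max lexx /= ge_max ler01 ge_min lexx.
have /andP[? ?] := IH j.+1 ((M j).*2%:R * t - (c j)%:R).
have /andP[? ?] := IH j.+1 ((M j).*2%:R * t - (M j)%:R - (c j)%:R).
by apply/andP; split; lra.
Qed.

Lemma continuous_stair k j : continuous (stair c k j).
Proof.
elim: k j => [|k IH] j x /=.
  apply: continuous_max; first exact: cvg_cst.
  by apply: continuous_min; [exact: cvg_cst | exact: cvg_id].
apply: cvgMl; apply: cvgD.
  apply: (@continuous_comp _ _ _ (fun t : R => (M j).*2%:R * t - (c j)%:R)).
    by apply: cvgB; [apply: cvgMr; exact: cvg_id | exact: cvg_cst].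
  exact: IH.
apply: (@continuous_comp _ _ _ (fun t : R => (M j).*2%:R * t - (M j)%:R - (c
  j)%:R)).
  apply: cvgB; last exact: cvg_cst.
  by apply: cvgB; [apply: cvgMr; exact: cvg_id | exact: cvg_cst].
exact: IH.
Qed.

Lemma window_sub i j t : window c i j t -> 0 < t < 1.
Proof.
elim: i j t => [//|i IH] j t /=.
have h := cM j; have h0 := c0 j; have m2 := M2 j.
have m0 : 0 < (M j).*2%:R :> R.
  by rewrite ltr0n double_gt0 (leq_ltn_trans _ (c_lt j)).
rewrite -(pmulr_rgt0 t m0) -(ltr_pM2l m0 t) mulr1.
by case/orP => /IH/andP[? ?]; apply/andP; split; lra.
Qed.

Lemma windowS i j t : window c i.+1 j t -> window c i j t.
Proof.
elim: i j t => [|i IH] j t; first exact: window_sub.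
by rewrite [X in X -> _]/= [X in _ -> X]/= => /orP[] /IH ->; rewrite ?orbT.
Qed.

Lemma window_leq i i' j t : (i <= i')%N -> window c i' j t -> window c i j t.
Proof.
move=> /subnKC <-; elim: (i' - i)%N => [|d IH]; first by rewrite addn0.
by rewrite addnS => /windowS.
Qed.

(** Off the windows, every argument reached after [i] levels lies outside [(0, 1)], where staircases
    of all depths agree with [clamp]. *)
Lemma stair_stable i k j t : ~~ window c i j t ->
  stair c (i + k) j t = stair c i j t.
Proof.
elim: i j t => [|i IH] j t /=; last first.
  by rewrite negb_or => /andP[? ?]; rewrite !IH.
rewrite negb_and -!leNgt => /orP[t0|t1].
  by rewrite stair_le0 // clamp_le0.
by rewrite stair_ge1 // clamp_ge1.
Qed.

(** Each level averages two values, starting from [0] or [1]; so off the windows the values are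
    multiples of [2^-1 ^+ i]. *)
Lemma stair_int i j t : ~~ window c i j t ->
  exists n : nat, 2 ^+ i * stair c i j t = n%:R.
Proof.
elim: i j t => [|i IH] j t /=.
  rewrite negb_and -!leNgt expr0 mul1r => /orP[t0|t1].
    by exists 0%N; rewrite clamp_le0.
  by exists 1%N; rewrite clamp_ge1.
rewrite negb_or => /andP[/IH[m hm] /IH[n hn]]; exists (m + n)%N.
by rewrite natrD -hm -hn exprS; field; rewrite ?pnatr_eq0.
Qed.

Lemma stair_near i k j t : `|stair c (i + k) j t - stair c i j t| <= 2^-1 ^+ i.
Proof.
elim: i j t => [|i IH] j t.
  rewrite expr0 add0n.
  have /andP[? ?] := stair_ge0_le1 k j t.
  have /andP[? ?] := stair_ge0_le1 0 j t.
  by rewrite ler_norml; apply/andP; split; lra.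
have outside t' j' : ~~ (0 < t' < 1) ->
    stair c (i + k) j' t' = stair c i j' t'.
  by move=> h; apply: stair_stable; apply: contra h; exact: window_sub.
rewrite addSn /= exprS.
set s := (M j).*2%:R * t - (c j)%:R.
have -> : (M j).*2%:R * t - (M j)%:R - (c j)%:R = s - (M j)%:R :> R.
  by rewrite /s; lra.
have h := cM j; have h0 := c0 j.
have := IH j.+1 s; have := IH j.+1 (s - (M j)%:R).
(* The two copies live on disjoint intervals, so at most one term of the average carries an error,
   and that error is halved. *)
have [s1|s1] := boolP (0 < s < 1).
  rewrite [in stair _ _ _ (s - _)]outside; last first.
    by move: s1; rewrite negb_and -!leNgt => /andP[? ?]; apply/orP; left; lra.
  by move=> _; rewrite !ler_norml => /andP[? ?]; apply/andP; split; lra.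
rewrite (outside s j.+1 s1).
by move=> + _; rewrite !ler_norml => /andP[? ?]; apply/andP; split; lra.
Qed.

End Branch.

(** Down to the first level where the choices differ, a common point would lie in the same copies;
    at that level the choices select different intervals of one subdivision. *)
Lemma window_disjoint c c' i j t :
  (forall l, (c l < M l)%N) -> (forall l, (c' l < M l)%N) ->
  (forall l, (l < i)%N -> c (j + l)%N = c' (j + l)%N) ->
  c (j + i)%N != c' (j + i)%N ->
  window c i.+1 j t -> ~~ window c' i.+1 j t.
Proof.
move=> cM c'M; elim: i j t => [|i IH] j t.
  rewrite addn0 => _ ne.
  (* After scaling by [2 * M j], windows are unit intervals starting at integers, and the four
     integers involved are compared in pairs. *)
  suff H : forall a b : nat, a != b -> forall s : R, 0 < s - a%:R < 1 -> ~~ (0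
    < s - b%:R < 1).
    set s := (M j).*2%:R * t.
    have sub a : s - (M j)%:R - a%:R = s - (M j + a)%N%:R by rewrite natrD; lra.
    have := cM j; have := c'M j => lt' lt.
    rewrite /= !sub => /orP[] h; rewrite negb_or !(H _ _ _ _ h) //.
    - by apply: contraTneq lt => ->; rewrite -leqNgt leq_addr.
    - by rewrite eqn_add2l.
    - by apply: contraTneq lt' => <-; rewrite -leqNgt leq_addr.
  move=> a b ab s /andP[h1 h2]; apply/negP => /andP[h3 h4].
  have : (a < b + 1)%N by rewrite -(ltr_nat R) natrD; lra.
  have : (b < a + 1)%N by rewrite -(ltr_nat R) natrD; lra.
  by rewrite !addn1 !ltnS => ba aab; move: ab; rewrite eqn_leq ba aab.
move=> eqc ne; rewrite !(windowS_or _ i.+1 j).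
have e0 : c j = c' j by have := eqc 0%N (ltn0Sn _); rewrite addn0.
have {}IH s : window c i.+1 j.+1 s -> ~~ window c' i.+1 j.+1 s.
  apply: IH; last by rewrite addSnnS.
  by move=> l li; rewrite addSnnS; apply: eqc; rewrite ltnS.
rewrite -e0 => {e0}.
set s := (M j).*2%:R * t - (c j)%:R.
have -> : (M j).*2%:R * t - (M j)%:R - (c j)%:R = s - (M j)%:R :> R.
  by rewrite /s; lra.
have m1 : 1 <= (M j)%:R :> R by rewrite ler1n (leq_ltn_trans _ (cM j)).
case/orP => h; rewrite negb_or; apply/andP; split.
- exact: IH h.
- apply/negP => /(window_sub c'M)/andP[? ?].
  by have /(window_sub cM)/andP[? ?] := h; lra.
- apply/negP => /(window_sub c'M)/andP[? ?].
  by have /(window_sub cM)/andP[? ?] := h; lra.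
- exact: IH h.
Qed.

Lemma window_prefix c c' i j t :
  (forall l, (l < i)%N -> c (j + l)%N = c' (j + l)%N) ->
  window c i j t = window c' i j t.
Proof.
elim: i j t => [//|i IH] j t eqc /=.
have e0 : c j = c' j by have := eqc 0%N (ltn0Sn _); rewrite addn0.
by rewrite e0 !(IH j.+1) // => l li; rewrite addSnnS; apply: eqc; rewrite ltnS.
Qed.

Definition stair_lim c t : R := lim (stair c k 0 t @[k --> \oo]).

Section Limit.
Variable c : nat -> nat.
Hypothesis c_lt : forall j, (c j < M j)%N.

Lemma stair_cvg t : stair c k 0 t @[k --> \oo] --> stair_lim c t.
Proof.
apply: cauchy_cvg; apply/cauchyP => e e0.
have [i ie] := exists_half_expr_lt e0.
exists (stair c i 0 t); exists i => // k /= /subnKC <-.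
rewrite /ball /= distrC; apply: le_lt_trans ie; exact: stair_near.
Qed.

Lemma stair_limE t (P : set R) : closed P ->
  (\forall k \near \oo, P (stair c k 0 t)) -> P (stair_lim c t).
Proof. by move=> cP h; apply: (closed_cvg _ cP h); exact: stair_cvg. Qed.

Lemma stair_lim_le0 t : t <= 0 -> stair_lim c t = 0.
Proof.
move=> t0; apply: (@stair_limE t [set 0]); first exact: closed_eq.
by apply: nearW => k /=; rewrite stair_le0.
Qed.

Lemma stair_lim_ge1 t : 1 <= t -> stair_lim c t = 1.
Proof.
move=> t0; apply: (@stair_limE t [set 1]); first exact: closed_eq.
by apply: nearW => k /=; rewrite stair_ge1.
Qed.

Lemma stair_lim_ge0_le1 t : 0 <= stair_lim c t <= 1.
Proof.
suff: stair_lim c t \in `[0, 1] by rewrite in_itv.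
apply: (@stair_limE t [set` `[0, 1]]).
  exact: interval_closed.
by apply: nearW => k /=; rewrite in_itv /= stair_ge0_le1.
Qed.

Lemma stair_lim_near i t : `|stair_lim c t - stair c i 0 t| <= 2^-1 ^+ i.
Proof.
suff: stair_lim c t \in `[stair c i 0 t - 2^-1 ^+ i, stair c i 0 t + 2^-1 ^+ i].
  by rewrite in_itv /= -ler_distl.
apply: (@stair_limE t [set` `[stair c i 0 t - 2^-1 ^+ i, stair c i 0 t + 2^-1
  ^+ i]]).
  exact: interval_closed.
by exists i => // k /= /subnKC <-; rewrite in_itv /= -ler_distl stair_near.
Qed.

Lemma stair_lim_int i t : ~~ window c i 0 t ->
  exists n : nat, 2 ^+ i * stair_lim c t = n%:R.
Proof.
move=> nw; have [n hn] := stair_int nw; exists n; rewrite -hn; congr (_ * _).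
apply: (@stair_limE t [set stair c i 0 t]); first exact: closed_eq.
by exists i => // k /= /subnKC <-; exact: stair_stable.
Qed.

Lemma continuous_stair_lim : continuous (stair_lim c).
Proof.
move=> t; apply/cvgrPdist_lt => e e0.
have [i ie] := exists_half_expr_lt (divr_gt0 e0 (ltr0n R 3)).
have /cvgrPdist_lt/(_ (e / 3)) := @continuous_stair c i 0 t.
rewrite divr_gt0 // => /(_ isT); apply: filterS => s.
have := stair_lim_near i t; have := stair_lim_near i s.
rewrite !ler_norml !ltr_norml => /andP[? ?] /andP[? ?] /andP[? ?].
by apply/andP; split; lra.
Qed.

End Limit.

End Staircase.

(** * Counting codes *)

Section Counting.
Context {R : realType}.

(** Expanding the power gives the sum of the weights of all words; it is bounded below by the part
    coming from [P]. *)
Lemma card_ffun_weight (I T : finType) (w : T -> R) (b : R)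
    (P : {set {ffun I -> T}}) :
  (forall t, 0 <= w t) ->
  (forall u, u \in P -> b <= \prod_i w (u i)) ->
  #|P|%:R * b <= (\sum_t w t) ^+ #|I|.
Proof.
move=> w0 bP; have -> : (\sum_t w t) ^+ #|I| = \prod_(i : I) \sum_t w t.
  by rewrite prodr_const.
rewrite bigA_distr_bigA /= mulr_natl -sumr_const.
rewrite [leRHS](bigID (mem P)) /= -[leLHS]addr0 lerD //; first exact: ler_sum.
by apply: sumr_ge0 => u _; apply: prodr_ge0.
Qed.

Lemma sum_geometric_le (q : R) n : 0 <= q -> q <= 1 / 4 ->
  \sum_(j < n) q ^+ j <= 4 / 3.
Proof.
move=> q0 q1; elim: n => [|n IH]; first by rewrite big_ord0; lra.
rewrite big_ord_recl expr0.
under eq_bigr => i _ do rewrite lift0 exprS.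
rewrite -mulr_sumr.
have : q * (\sum_(i < n) q ^+ i) <= 1 / 4 * (4 / 3).
  by apply: ler_pM => //; apply: sumr_ge0 => i _; exact: exprn_ge0.
by lra.
Qed.

(** [None] stands for a starred position, [Some (j, v)] for a recorded level and value. Values too
    large for their level get weight [0] below. *)
Let symbol m := option ('I_m.+1 * 'I_(2 ^ m.+1).+1).

Let weight m (q : R) (s : symbol m) : R :=
  if s is Some (j, v) then if (v <= 2 ^ j.+1)%N then q ^+ j.+1 else 0 else 1.

Let weight_ge0 m (q : R) s : 0 <= q -> 0 <= @weight m q s.
Proof.
by move=> q0; case: s => [[j v]|] //=; case: ifP => // _; exact: exprn_ge0.
Qed.

Let sum_weight m (q : R) : 0 <= q -> q <= 1 / 8 ->
  \sum_s @weight m q s <= 1 + 4 * q.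
Proof.
move=> q0 q8; rewrite (bigD1 None) //= lerD2l.
rewrite (@reindex_omap _ _ _ _ _ Some id) /=; last by case.
under eq_bigl => p do rewrite eqxx.
pose F (j : 'I_m.+1) (v : 'I_(2 ^ m.+1).+1) : R :=
  if (v <= 2 ^ j.+1)%N then q ^+ j.+1 else 0.
rewrite (eq_bigr (fun p => F p.1 p.2)); last by case.
rewrite -(pair_bigA _ F) /= {}/F.
(* Level [j] admits [2 ^ j.+1 + 1 <= 3 * 2 ^ j] values, which leaves a geometric series of ratio
   [2 * q]. *)
have le1 (j : 'I_m.+1) : \sum_(v < (2 ^ m.+1).+1) (if (v <= 2 ^ j.+1)%N then q
  ^+ j.+1 else 0)
    <= 3 * q * (2 * q) ^+ j.
  rewrite -big_mkcond /=; under eq_bigl => v do rewrite -ltnS.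
  rewrite -(big_ord_widen _ (fun=> q ^+ j.+1)); last first.
    by rewrite ltnS leq_exp2l // ltn_ord.
  rewrite sumr_const card_ord -[leLHS]mulr_natl.
  have -> : 3 * q * (2 * q) ^+ j = (3 * 2 ^ j)%N%:R * q ^+ j.+1.
    by rewrite natrM natrX exprS exprMn; ring.
  rewrite ler_wpM2r ?exprn_ge0 // ler_nat.
  by rewrite expnS -addn1 mulSn addnC leq_add2r expn_gt0.
apply: (le_trans (ler_sum _ (fun j _ => le1 j))).
rewrite -mulr_sumr.
have := @sum_geometric_le (2 * q) m.+1.
set S := \sum_(j < m.+1) _ => h.
have {}h : S <= 4 / 3 by apply: h; lra.
have : 3 * q * S <= 3 * q * (4 / 3) by apply: ler_wpM2l => //; lra.
by lra.
Qed.

(* [x] is coded by the positions where [star x] fails, together with the values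
   of [lev x] and [val x] there. A code has weight [expR (- L * cost)], while
   the weights of all possible codes add up to at most
   [(1 + 4 * expR (- L)) ^+ #|I|]. *)
Lemma card_codes (X : Type) (I : finType) (B : set X)
    (star : X -> I -> bool) (lev val : X -> I -> nat) m (L C : R) :
  8 <= L ->
  (forall x i, (lev x i <= m)%N) ->
  (forall x i, (val x i <= 2 ^ (lev x i).+1)%N) ->
  (forall x, B x -> (\sum_i ~~ star x i * (lev x i).+1)%N%:R <= C) ->
  exists s : seq (set X),
    [/\ (size s)%:R <= expR (4 * expR (- L) * #|I|%:R + L * C),
        forall x, B x -> exists2 W, W \in s & W x &
        forall W x x', W \in s -> W x -> W x' ->
          [/\ B x, B x' & forall i, star x i = star x' i /\
            (~~ star x i -> lev x i = lev x' i /\ val x i = val x' i)]].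
Proof.
move=> L8 levm val2 cost.
pose q := expR (- L).
have q0 : 0 < q by exact: expR_gt0.
have q8 : q <= 1 / 8.
  rewrite /q expRN -div1r ler_pdivrMr ?expR_gt0 //.
  by have := expR_ge1Dx L; lra.
pose code x : {ffun I -> symbol m} := [ffun i => if star x i then None else
  Some (Ordinal (levm x i : (lev x i < m.+1)%N), inord (val x i))].
have valK x i : (inord (val x i) : 'I_(2 ^ m.+1).+1) = val x i :> nat.
  rewrite inordK // ltnS (leq_trans (val2 x i)) // leq_exp2l //.
  exact: levm.
pose P := [set u : {ffun I -> symbol m} | `[< exists2 x, B x & code x = u
  >]]%SET.
exists [seq [set x | B x /\ code x = u] | u <- enum P]; split.
- rewrite size_map -cardE expRD.
  rewrite -ler_pdivrMr ?expR_gt0 // -expRN.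
  apply: (@le_trans _ _ ((1 + 4 * q) ^+ #|I|)); last first.
    rewrite expRM_natr.
    apply: lerXn2r; rewrite ?nnegrE ?expR_ge0 //; first by lra.
    by rewrite expR_ge1Dx.
  apply: (@le_trans _ _ ((\sum_s @weight m q s) ^+ #|I|)); last first.
    apply: lerXn2r; rewrite ?nnegrE; first by apply: sumr_ge0 => s _;
      apply: weight_ge0; lra.
      by lra.
    by apply: sum_weight => //; lra.
  apply: card_ffun_weight; first by move=> t; apply: weight_ge0; lra.
  move=> u; rewrite inE => /asboolP[x Bx <-].
  rewrite (eq_bigr (fun i => q ^+ (~~ star x i * (lev x i).+1))%N); last first.
    move=> i _; rewrite ffunE; case: (star x i) => //=.
    by rewrite valK val2 mul1n.
  rewrite prodrXr /q -expRM_natl ler_expR mulrN lerN2 mulrC ler_wpM2l ?cost //.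
  by lra.
- move=> x Bx; exists [set y | B y /\ code y = code x] => //.
  by apply: map_f; rewrite mem_enum inE; apply/asboolP; exists x.
- move=> W x x' /mapP[u _ ->] /= [Bx xu] [Bx' x'u]; split => // i.
  have := congr1 (fun h : {ffun I -> symbol m} => h i) (etrans xu (esym x'u)).
  rewrite !ffunE; case: (star x i) (star x' i) => [] [] //= [elev].
  by move=> /(congr1 (@nat_of_ord _)); rewrite !valK.
Qed.

End Counting.

(** * Coverings from predictions *)

Section Covering.
Context {R : realType} {G : groupType} {X : Type}.
Implicit Types (a : G -> X -> X) (U : set (set X)) (F : {fset G}) (W : set X).

Definition small_along a U F W :=
  forall g, g \in F -> exists2 A, U A & forall x, W x -> A (a g x).

Definition coverable a U F (B : set X) (N : R) := exists s : seq (set X),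
  [/\ (size s)%:R <= N, forall W, W \in s -> small_along a U F W &
      forall x, B x -> exists2 W, W \in s & W x].

Definition threshold_cover (f : X -> R) : set (set X) :=
  [set A | A = [set x | 0 < f x] \/ A = [set x | f x < 1]].

End Covering.

(** Induction on the number of elements of [F] below [g], which drops strictly along [r] by
    transitivity and irreflexivity. *)
Lemma prec_ind {G : groupType} (r : Ord G) (F : {fset G}) (P : G -> Prop) :
  (forall g, g \in F -> (forall h, h \in F -> prec r h g -> P h) -> P g) ->
  forall g, g \in F -> P g.
Proof.
move=> IH g; have [rA rT] := set_valP r.
have [n] := ubnP #|` [fset h in F | prec r h g]%fset|.
elim: n g => // n IHn g lt_n gF; apply: IH => // h hF hg; apply: IHn => //.
rewrite -ltnS; apply: leq_trans lt_n; rewrite ltnS.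
apply: fproper_ltn_card; rewrite fproperE; apply/andP; split.
  by apply/fsubsetP => l; rewrite !inE => /andP[-> lh]; exact: (rT _ _ _ lh hg).
apply/negP => /fsubsetP/(_ h); rewrite !inE hF /= => /(_ hg) hh.
by have := rA _ _ hh; rewrite -/(prec r h h) hh.
Qed.

Lemma natr_dist_lt1 {R : realDomainType} (n p : nat) :
  `|n%:R - p%:R : R| < 1 -> n = p.
Proof.
rewrite ltr_norml => /andP[lt1 lt2]; apply/eqP.
by rewrite eqn_leq; apply/andP; split; rewrite -ltnS -(ltr_nat R) -natr1; lra.
Qed.

Lemma sum_half_lt1 {R : realFieldType} m : \sum_(i < m) 2^-1 ^+ i.+1 <= 1 :> R.
Proof.
suff -> : \sum_(i < m) 2^-1 ^+ i.+1 = 1 - 2^-1 ^+ m :> R.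
  by rewrite gerBl exprn_ge0.
elim: m => [|m IH]; first by rewrite big_ord0 expr0; lra.
by rewrite big_ord_recr /= IH exprS; lra.
Qed.

Section Prediction.
Context {R : realType} {G : groupType} {X Y : metricType R}.
Variables (aX : G -> X -> X) (pi : X -> Y) (e : nat -> G).

(* The precision [2^-1] is the distance between consecutive values of a
   staircase outside its windows of the first level. *)
Definition predicts (phi : X -> R) m (r : Ord G) := forall x x' : X,
  (forall i, (i < m)%N -> prec r (e i) 1%g ->
    `|phi (aX (e i) x) - phi (aX (e i) x')| < m.+1%:R^-1) ->
  ball (pi x) m.+1%:R^-1 (pi x') -> `|phi x - phi x'| < 2^-1.

Variables (f : X -> R) (M c : nat -> nat).
Hypothesis c_lt : forall j, (c j < M j)%N.
Hypothesis aX_mul : forall g h x, aX (g * h)%g x = aX g (aX h x).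

(** The index is shifted: depth [0] is all of [(0, 1)], so the first windows that matter have depth
    [1]. *)
Definition visits (F : {fset G}) i x : nat :=
  \sum_(g : F) window M c i.+1 0 (f (aX (val g) x)).

Let phi x := stair_lim M c (f x).

(** As windows are nested, this is the greatest depth, among those up to [m], of a window containing
    [t], or [0] if there is none. *)
Let level m (t : R) : nat := \sum_(i < m) window M c i.+1 0 t.

Let level_le m t : (level m t <= m)%N.
Proof.
rewrite -[leqRHS]card_ord -sum1_card leq_sum // => i _; exact: leq_b1.
Qed.

Let level_window m t : (level m t < m)%N -> ~~ window M c (level m t).+1 0 t.
Proof.
move=> lt_m; apply/negP => w.
suff: (level m t < level m t)%N by rewrite ltnn.
rewrite {2}/level (bigID (fun i : 'I_m => (i < (level m t).+1)%N)) /=.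
apply: leq_trans (leq_addr _ _).
rewrite (eq_bigr (fun=> 1%N)); last first.
  by move=> i lti; rewrite -windowS_or (window_leq c_lt lti w).
by rewrite -(big_ord_widen _ (fun=> 1%N)) // sum_nat_const card_ord muln1.
Qed.

(** Starred positions are well predicted and off the windows of depth [1]; at the others the code
    records the level and a truncated value of [phi]. Rare visits make the codes few, and induction
    along [r] shows that points with the same code have nearly equal values of [phi] along [F]. *)
Lemma coverable_branch (r : Ord G) (F : {fset G}) m (eta L kappa : R) (D : set
  X) :
  8 <= L -> 0 <= eta -> 4 * expR (- L) + L * (4 * eta) <= kappa ->
  (\sum_(g : F) ~~ `[< predicts phi m (Ord_act (val g) r) /\
      forall i, (i < m)%N -> (e i * val g)%g \in F >])%N%:R <=
    2 * eta * #|` F|%:R ->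
  (forall g x x', g \in F -> D x -> D x' ->
    ball (pi (aX g x)) m.+1%:R^-1 (pi (aX g x'))) ->
  coverable aX (threshold_cover f) F
    (D `&` [set x | forall i, (i <= m)%N ->
      (visits F i x)%:R <= eta * 2^-1 ^+ i.+1 * #|` F|%:R])
    (expR (kappa * #|` F|%:R)).
Proof.
move=> L8 eta0 le_kappa bad closeD.
pose good g := `[< predicts phi m (Ord_act g r) /\
      forall i, (i < m)%N -> (e i * g)%g \in F >].
pose star x (g : F) :=
  good (val g) && ~~ window M c 1 0 (f (aX (val g) x)).
pose lev x (g : F) := level m (f (aX (val g) x)).
pose vl x (g : F) := Num.truncn (2 ^+ (lev x g).+1 * phi (aX (val g) x)).
set B := D `&` _.
pose n : R := #|` F|%:R.
have n0 : 0 <= n by exact: ler0n.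
have phi01 x : 0 <= phi x <= 1 by exact: stair_lim_ge0_le1.
have [||x Bx|s [size_s cov_s same_s]] :=
    @card_codes R X F B star lev vl m L (4 * eta * n) L8.
- by move=> x g; exact: level_le.
- move=> x g; rewrite /vl -ltnS truncn_lt_nat; last first.
    by rewrite mulr_ge0 ?exprn_ge0 //; case/andP: (phi01 (aX (val g) x)).
  rewrite -[ltRHS]natr1 natrX ltr_pwDr // ler_piMr ?exprn_ge0 //.
  by case/andP: (phi01 (aX (val g) x)).
(* The [1] in [(lev x g).+1] is paid by a bad position or a window of depth [1], the rest by the
   visits at each depth. The total is at most [(2 + 1/2 + 1) * eta * n]. *)
- have le_cost : (\sum_g ~~ star x g * (lev x g).+1 <=
      \sum_(g : F) ~~ good (val g) + visits F 0 x + \sum_(i < m) visits F i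
        x)%N.
    rewrite [X in (_ <= _ + X)%N]exchange_big /= -!big_split /=.
    apply: leq_sum => g _.
    rewrite -[_ || _]/(window M c 1 0 (f (aX (val g) x))) -/(level m _) -/(lev
      x g) /star.
    move: (lev x g) (good _) (window M c 1 0 _) => l [] [] //=;
      rewrite ?mul0n ?mul1n ?add0n ?addn0 ?addSn ?add0n //; exact: leqW.
  move: le_cost; rewrite -(ler_nat R) => /le_trans; apply.
  rewrite !natrD; have [_ few] := Bx.
  have := few 0%N (leq0n _); rewrite expr1.
  have : (\sum_(i < m) visits F i x)%N%:R <= eta * n.
    rewrite natr_sum; apply: (@le_trans _ _ (\sum_(i < m) eta * 2^-1 ^+ i.+1 *
      n)).
      by apply: ler_sum => i _; apply: few; exact: ltnW.
    rewrite -mulr_suml -mulr_sumr ler_wpM2r //.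
    by rewrite ler_piMr // sum_half_lt1.
  move: bad; rewrite -/n.
  by have : 0 <= eta * n; [exact: mulr_ge0 | lra].
exists s; split => //.
- apply: le_trans size_s _; rewrite ler_expR.
  rewrite -cardfE -/n; have : (4 * expR (- L) + L * (4 * eta)) * n <= kappa * n.
    exact: ler_wpM2r.
  by lra.
move=> W Ws.
(* The same tolerance is recovered at every step of the induction, so errors do not accumulate; it
   is below the [m.+1%:R^-1] required by [predicts]. *)
have near x x' g : W x -> W x' -> g \in F ->
    `|phi (aX g x) - phi (aX g x')| <= 2^-1 ^+ m.+1.
  move=> Wx Wx'; have [[Dx _] [Dx' _] same] := same_s W x x' Ws Wx Wx'.
  move: g; apply: (prec_ind (r := r)) => g gF IH.
  have /= [estar elev] := same [` gF]%fset.
  have [st|nst] := boolP (star x [` gF]%fset).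
    have st' : star x' [` gF]%fset by rewrite -estar.
    have /andP[/asboolP[pred_g inF] w] := st; have /andP[_ w'] := st'.
    have : `|phi (aX g x) - phi (aX g x')| < 2^-1.
      apply: pred_g => [i im ri|]; last exact: closeD.
      rewrite -!aX_mul; apply: (@le_lt_trans _ _ (2^-1 ^+ m.+1)).
        by apply: IH; [exact: inF | move: ri; rewrite /prec /= mul1g].
      by rewrite exprVn ltf_pV2 ?posrE ?exprn_gt0 // -natrX ltr_nat ltn_expl.
    (* Off the windows of depth [1] both values are multiples of [1/2]; being less than [1/2] apart,
       they coincide. *)
    have [k ek] := stair_lim_int c_lt w; have [k' ek'] := stair_lim_int c_lt w'.
    move: ek ek'; rewrite !expr1 -/(phi _) -/(phi _) => ek ek' lt1.
    have kk' : k = k'.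
      apply: (@natr_dist_lt1 R); rewrite -ek -ek'.
      by move: lt1; rewrite !ltr_norml => /andP[? ?]; apply/andP; split; lra.
    have -> : phi (aX g x) = phi (aX g x') by move: ek ek'; rewrite kk'; lra.
    by rewrite subrr normr0 exprn_ge0.
  have [el ev] := elev nst; move: el ev; rewrite /vl /lev /=.
  set t := f (aX g x); set t' := f (aX g x') => el.
  rewrite -el -[phi (aX g x)]/(stair_lim M c t).
  rewrite -[phi (aX g x')]/(stair_lim M c t').
  set j := level m t => ev.
  have lim_ge0 (s' : R) : 0 <= stair_lim M c s' by case/andP:
    (stair_lim_ge0_le1 c_lt s').
  have lt1 : `|2 ^+ j.+1 * stair_lim M c t - 2 ^+ j.+1 * stair_lim M c t'| < 1.
    have /andP[] := truncn_itv (mulr_ge0 (exprn_ge0 j.+1 (ler0n R 2)) (lim_ge0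
      t)).
    have /andP[] := truncn_itv (mulr_ge0 (exprn_ge0 j.+1 (ler0n R 2)) (lim_ge0
      t')).
    rewrite ev -!natr1 ltr_norml => ? ? ? ?; apply/andP; split; lra.
  (* At level [m] equal truncations give the tolerance directly. Below it, [t] and [t'] are off the
     windows of depth [j.+1], where the values are multiples of [2^-1 ^+ j.+1], hence equal. *)
  move: (level_le m t); rewrite leq_eqVlt => /orP[/eqP jm|jm].
    rewrite -jm -/j exprVn -[leRHS]div1r ler_pdivlMr ?exprn_gt0 // mulrC.
    by rewrite -[X in X * _]ger0_norm ?exprn_ge0 // -normrM mulrBr ltW.
  have := level_window jm; rewrite -/j => wj.
  have wj' : ~~ window M c j.+1 0 t'.
    by move: jm; rewrite /j el; exact: level_window.
  have [k ek] := stair_lim_int c_lt wj; have [k' ek'] := stair_lim_int c_lt wj'.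
  have kk' : k = k' by apply: (@natr_dist_lt1 R); rewrite -ek -ek'.
  have -> : stair_lim M c t = stair_lim M c t'.
    have /mulfI : (2 ^+ j.+1 : R) != 0 by rewrite expf_neq0.
    by apply; rewrite ek ek' kk'.
  by rewrite subrr normr0 exprn_ge0.
move=> g gF.
(* Values of [f] both [<= 0] and [>= 1] on one piece would make [phi] jump from [0] to [1], against
   [near]. *)
have [[x Wx f0]|f0] := pselect (exists2 x, W x & f (aX g x) <= 0); last first.
  exists [set x | 0 < f x]; first by left.
  by move=> x Wx /=; rewrite ltNge; apply/negP => ?; apply: f0; exists x.
exists [set x | f x < 1]; first by right.
move=> x' Wx' /=; rewrite ltNge; apply/negP => f1.
have := near x x' g Wx Wx' gF.
rewrite /phi stair_lim_le0 // stair_lim_ge1 // sub0r normrN normr1.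
rewrite leNgt exprn_ilt1 //; lra.
Qed.

End Prediction.

(** * From closed subalgebras to predictions of finite precision *)

Section Determination.
Context {R : realType} {G : groupType} {X Y : metricType R}.
Variables (aX : G -> X -> X) (pi : X -> Y) (e : nat -> G).
Hypothesis X_compact : compact [set: X].
Hypothesis aX_continuous : forall g, continuous (aX g).
Hypothesis pi_continuous : continuous pi.
Hypothesis e_surj : forall g, exists i, e i = g.

(** The continuous functions that agree on any two points with the same past and the same image
    under [pi] form a closed subalgebra containing the generators. *)
Lemma predictable_determined (phi : X -> R) (r : Ord G) : continuous phi ->
  smallest (@closed_subalgebra R X)
    ([set phi \o aX g | g in [set g | prec r g 1%g]] `|`
     [set h \o pi | h in [set h : Y -> R | continuous h]]) phi ->
  forall x x' : X, (forall g, prec r g 1%g -> phi (aX g x) = phi (aX g x')) ->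
    pi x = pi x' -> phi x = phi x'.
Proof.
move=> phi_cont.
pose A := [set h : X -> R | continuous h /\ forall x x' : X,
  (forall g, prec r g 1%g -> phi (aX g x) = phi (aX g x')) ->
    pi x = pi x' -> h x = h x'].
suff [sA genA] : closed_subalgebra A /\
    ([set phi \o aX g | g in [set g | prec r g 1%g]] `|`
     [set h \o pi | h in [set h : Y -> R | continuous h]]) `<=` A.
  by move=> /(_ A (conj sA genA))[].
split; last first.
  move=> h [[g /= rg <-]|[h' /= ch' <-]]; split.
  - by move=> x; apply: continuous_comp; [exact: aX_continuous|exact: phi_cont].
  - by move=> x x' /(_ g rg).
  - by move=> x; apply: continuous_comp; [exact: pi_continuous|exact: ch'].
  - by move=> x x' _ /= ->.
split.
- by move=> h [].
- move=> h; have approx (eps : R) : 0 < eps ->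
      closure (A : set {uniform X -> R}) h ->
      exists2 h', A h' & forall x, `|h x - h' x| < eps.
    move=> eps0 /(_ [set h' | forall x, `|h x - h' x| < eps]) [].
      apply/uniform_nbhs; exists [set p : R * R | `|p.1 - p.2| < eps]; split.
        by rewrite -entourage_ballE; exists eps.
      by move=> h' /= H x; apply: H.
    by move=> h' [Ah' H]; exists h'.
  move=> clh; split.
    move=> x; apply/cvgrPdist_lt => eps eps0.
    have [h' [h'c _] hh'] := approx (eps / 3) (divr_gt0 eps0 (ltr0n R 3)) clh.
    have /cvgrPdist_lt/(_ (eps / 3)) := h'c x.
    rewrite divr_gt0 // => /(_ isT); apply: filterS => x'.
    move: (hh' x) (hh' x'); rewrite !ltr_norml => /andP[? ?] /andP[? ?] /andP[?
      ?].
    by apply/andP; split; lra.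
  move=> x x' past pixx'; apply/eqP; rewrite -subr_eq0 -normr_le0.
  apply/ler_addgt0Pl => eps eps0; rewrite addr0.
  have [h' [_ h'd] hh'] := approx (eps / 2) (divr_gt0 eps0 (ltr0n R 2)) clh.
  have := h'd x x' past pixx'; move: (hh' x) (hh' x').
  rewrite !ltr_norml ler_norml => /andP[? ?] /andP[? ?] ?.
  by apply/andP; split; lra.
- by split => // x; exact: cvg_cst.
- split.
  + move=> h1 h2 [c1 d1] [c2 d2]; split => [x|x x' past pixx' /=].
      by apply: cvgD; [exact: c1|exact: c2].
    by rewrite (d1 x x') ?(d2 x x').
  + move=> h1 h2 [c1 d1] [c2 d2]; split => [x|x x' past pixx' /=].
      by apply: cvgM; [exact: c1|exact: c2].
    by rewrite (d1 x x') ?(d2 x x').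
  + move=> c h1 [c1 d1]; split => [x|x x' past pixx' /=].
      by apply: cvgM; [exact: cvg_cst|exact: c1].
    by rewrite (d1 x x').
Qed.

Lemma near_invS_lt (eps : R) : 0 < eps ->
  \forall m \near \oo, m.+1%:R^-1 < eps.
Proof.
move=> eps0; exists (Num.truncn eps^-1).+1 => // m /= lt_m.
rewrite invf_plt ?posrE ?ltr0n //.
apply: lt_le_trans (truncnS_gt _) _; rewrite ler_nat; exact: leqW.
Qed.

(** Compactness of [X * X]: at each pair either the values of [phi] are close, or [pi] separates the
    points, or some element of the past does. Each alternative persists on a neighbourhood for all
    large [m]. *)
Lemma determined_predicts (phi : X -> R) (r : Ord G) : continuous phi ->
  (forall x x' : X, (forall g, prec r g 1%g -> phi (aX g x) = phi (aX g x')) ->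
    pi x = pi x' -> phi x = phi x') ->
  exists m, predicts aX pi e phi m r.
Proof.
move=> phi_cont det.
have := compact_setX X_compact X_compact.
move=> /compact_near_coveringP/(_ nat \oo (fun m (z : X * X) =>
  (forall i, (i < m)%N -> prec r (e i) 1%g ->
    `|phi (aX (e i) z.1) - phi (aX (e i) z.2)| < m.+1%:R^-1) ->
  ball (pi z.1) m.+1%:R^-1 (pi z.2) -> `|phi z.1 - phi z.2| < 2^-1) _).
case.
  move=> [x x'] _.
  have near_pair (h : X -> R) (eps : R) : continuous h -> 0 < eps ->
      \forall w \near (x, x'), `|h x - h w.1| < eps /\ `|h x' - h w.2| < eps.
    move=> h_cont eps0.
    have h1 : {for (x, x'), continuous (fun w : X * X => h w.1)}.
      apply: (@continuous_comp _ _ _ fst h); first exact: cvg_fst.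
      exact: h_cont.
    have h2 : {for (x, x'), continuous (fun w : X * X => h w.2)}.
      apply: (@continuous_comp _ _ _ snd h); first exact: cvg_snd.
      exact: h_cont.
    move/cvgrPdist_lt/(_ _ eps0) : h1; move/cvgrPdist_lt/(_ _ eps0) : h2.
    by apply: filterS2 => w.
  have [lt|ge] := ltP `|phi x - phi x'| 2^-1.
    pose d := (2^-1 - `|phi x - phi x'|) / 2.
    have d0 : 0 < d by rewrite /d; lra.
    near=> w m => _ _.
    have [] : `|phi x - phi w.1| < d /\ `|phi x' - phi w.2| < d.
      by near: w; exact: near_pair.
    have := ler_norm (phi x - phi x'); have := ler_norm (phi x' - phi x).
    rewrite (distrC (phi x') (phi x)) !ltr_norml /d.
    move=> ? ? /andP[? ?] /andP[? ?].
    by apply/andP; split; lra.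
  have [pixx'|pixx'] := eqVneq (pi x) (pi x'); last first.
    pose d := mdist (pi x) (pi x') / 3.
    have d0 : 0 < d by rewrite divr_gt0 // mdist_gt0.
    near=> w m => _ close.
    have md : m.+1%:R^-1 < d by near: m; exact: near_invS_lt.
    have near_pi : ball (pi x) d (pi w.1) /\ ball (pi x') d (pi w.2).
      near: w; apply: filterI.
        have : {for (x, x'), continuous (fun w : X * X => pi w.1)}.
          by apply: (@continuous_comp _ _ _ fst pi);
            [exact: cvg_fst|exact: pi_continuous].
        by move=> /cvg_ballP/(_ _ d0).
      have : {for (x, x'), continuous (fun w : X * X => pi w.2)}.
        by apply: (@continuous_comp _ _ _ snd pi);
          [exact: cvg_snd|exact: pi_continuous].
      by move=> /cvg_ballP/(_ _ d0).
    move: near_pi close; rewrite !ballEmdist /= => -[b1 b2] /lt_trans/(_ md) b3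
      {md}.
    have := metric_triangle (pi x) (pi w.1) (pi x').
    have := metric_triangle (pi w.1) (pi w.2) (pi x').
    rewrite [mdist (pi w.2) _]metric_sym.
    have -> : mdist (pi x) (pi x') = 3 * d by rewrite /d mulrC divfK.
    by move=> ? ?; exfalso; lra.
  have [g rg ne] : exists2 g, prec r g 1%g & phi (aX g x) != phi (aX g x').
    apply: contrapT => H; move: ge; rewrite (det x x') ?subrr ?normr0 //.
      by rewrite leNgt invr_gt0 ltr0n.
    by move=> g rg; apply/eqP/negPn/negP => ne; apply: H; exists g.
  have [i ei] := e_surj g.
  pose d := `|phi (aX g x) - phi (aX g x')| / 3.
  have d0 : 0 < d by rewrite divr_gt0 // normr_gt0 subr_eq0.
  near=> w m => /(_ i) past _.
  have md : m.+1%:R^-1 < d by near: m; exact: near_invS_lt.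
  have im : (i < m)%N by near: m; exact: nbhs_infty_gt.
  have [] : `|phi (aX g x) - phi (aX g w.1)| < d /\
            `|phi (aX g x') - phi (aX g w.2)| < d.
    near: w; apply: (near_pair (phi \o aX g)) => // z.
    by apply: continuous_comp; [exact: aX_continuous|exact: phi_cont].
  have := past im; rewrite ei => /(_ rg)/lt_trans/(_ md) {md past}.
  have : 3 * d <= `|phi (aX g x) - phi (aX g w.1)| +
     `|phi (aX g w.1) - phi (aX g w.2)| + `|phi (aX g x') - phi (aX g w.2)|.
    have -> : 3 * d = `|phi (aX g x) - phi (aX g x')| by rewrite /d mulrC divfK.
    rewrite (distrC (phi (aX g x')) (phi (aX g w.2))).
    have -> : phi (aX g x) - phi (aX g x') = phi (aX g x) - phi (aX g w.1) +
      (phi (aX g w.1) - phi (aX g w.2)) + (phi (aX g w.2) - phi (aX g x')) by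
        lra.
    by apply: le_trans (ler_normD _ _) _; rewrite lerD2r ler_normD.
  by move=> ? ? ? ?; exfalso; lra.
move=> m _ /(_ m (leqnn m)) H; exists m => x x' past close.
exact: (H (x, x')).
Unshelve. all: by end_near. Qed.

End Determination.

(** * Random orders *)

Section RandomOrder.
Context {R : realType} {G : groupType}.

Lemma continuous_prec (x y : G) : continuous (fun r : Ord G => prec r x y).
Proof.
move=> r.
apply: (@continuous_comp (Ord G) _ _ val (fun h : {ptws G * G -> bool} => h (x,
  y))).
  exact: (@initial_continuous (Ord G) {ptws G * G -> bool} val).
exact: (@proj_continuous (G * G)%type (fun=> bool) (x, y)).
Qed.

(** Cylinder sets. They are stable under complement and open, hence clopen and Borel. *)
Definition finitely_determined (A : set (Ord G)) := exists s : seq (G * G),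
  forall r r', (forall p, p \in s -> prec r p.1 p.2 = prec r' p.1 p.2) ->
    A r -> A r'.

Lemma finitely_determinedC A : finitely_determined A ->
  finitely_determined (~` A).
Proof.
move=> [s sA]; exists s => r r' rr' nA Ar'; apply: nA.
by apply: sA Ar' => p /rr'.
Qed.

Lemma open_finitely_determined A : finitely_determined A -> open A.
Proof.
move=> [s sA]; rewrite openE => r Ar.
have near_s : \forall r' \near r, forall p, p \in s ->
    prec r' p.1 p.2 = prec r p.1 p.2.
  elim: {sA} s => [|q s IH]; first by apply: (@filterE _ _ (nbhs_filter r)).
  have h : \forall r' \near r, prec r' q.1 q.2 = prec r q.1 q.2.
    have := @continuous_prec q.1 q.2 r [set b | b = prec r q.1 q.2].
    by apply; rewrite nbhs_principalE; apply/principal_filterP.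
  apply: (@filterS2 _ _ (nbhs_filter r) _ _ _ _ h IH) => r' e IH' p.
  by rewrite inE => /predU1P[->|/IH'].
by apply: (@filterS _ _ (nbhs_filter r) _ _ _ near_s) => r' e;
  apply: sA Ar => p /e ->.
Qed.

Lemma measurable_finitely_determined (A : set (Ord G)) :
  finitely_determined A -> measurable (A : set (borelOrd G)).
Proof. by move=> /open_finitely_determined oA; exact: sub_sigma_algebra. Qed.

(** First moment method: by invariance the expected count is [#|F|] times [nu A], and some order
    does no worse than the average. *)
Lemma exists_order_average (nu : probability (borelOrd G) R)
    (A : set (Ord G)) (eta : R) (F : {fset G}) :
  Ord_invariant nu -> finitely_determined A -> (nu A <= eta%:E)%E ->
  exists r, (\sum_(g : F) `[< A (Ord_act (val g) r) >])%N%:R <= eta * #|` F|%:R.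
Proof.
move=> inv fdA le_eta; apply: contrapT => none.
have mA := measurable_finitely_determined fdA.
have mAg g : measurable (Ord_act g @^-1` A : set (borelOrd G)).
  apply: measurable_finitely_determined; have [s sA] := fdA.
  exists [seq (p.1 * g, p.2 * g)%g | p <- s] => r r' rr'.
  by apply: sA => p ps; exact: (rr' _ (map_f _ ps)).
(* Counts are integers, so if every order violated the bound, every count would reach this [N],
   which exceeds [eta * #|F|]. *)
pose N := (Num.truncn (eta * #|` F|%:R)).+1.
have eta0 : 0 <= eta by rewrite -lee_fin; exact: le_trans (measure_ge0 _ _)
  le_eta.
have count_ge r : (N <= \sum_(g : F) `[< A (Ord_act (val g) r) >])%N.
  rewrite /N truncn_lt_nat ?mulr_ge0 // ltNge; apply/negP => H.
  by apply: none; exists r.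
have : (N%:R%:E <= (eta * #|` F|%:R)%:E)%E.
  apply: (@le_trans _ _ (\int[nu]_r (\sum_(g : F)
      (\1_(Ord_act (val g) @^-1` A : set (borelOrd G)) r)%:E))%E).
    rewrite -[leLHS]mule1 -(@probability_setT _ _ _ nu) -integral_cst //.
    apply: ge0_le_integral => //.
    - by move=> r _; rewrite /= lee_fin.
    - by apply: emeasurable_sum => g; apply/measurable_EFinP;
      exact: measurable_indic.
    - move=> r _; rewrite sumEFin lee_fin.
      apply: (@le_trans _ _ (\sum_(g : F) `[< A (Ord_act (val g) r) >])%N%:R).
        by rewrite ler_nat.
      rewrite natr_sum; apply: ler_sum => g _.
      rewrite indicE; case: asboolP => // h.
      by rewrite mem_set.
  rewrite ge0_integral_sum //; last first.
    by move=> g; apply/measurable_EFinP; exact: measurable_indic.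
  apply: (@le_trans _ _ (\sum_(g : F) eta%:E)%E).
    apply: lee_sum => g _; rewrite integral_indic // setIT.
    by have := le_eta; rewrite -(inv (val g) A mA).
  by rewrite sumEFin lee_fin sumr_const -cardfE mulr_natr.
rewrite lee_fin leNgt => /negP; apply.
by case/andP: (truncn_itv (mulr_ge0 eta0 (ler0n R #|` F|))).
Qed.

End RandomOrder.

Section RandomPrediction.
Context {R : realType} {G : groupType} {X Y : metricType R}.
Variables (aX : G -> X -> X) (pi : X -> Y) (e : nat -> G).
Hypothesis X_compact : compact [set: X].
Hypothesis aX_continuous : forall g, continuous (aX g).
Hypothesis pi_continuous : continuous pi.
Hypothesis e_surj : forall g, exists i, e i = g.

Lemma predicts_leq phi m m' (r : Ord G) : (m <= m')%N ->
  predicts aX pi e phi m r -> predicts aX pi e phi m' r.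
Proof.
move=> mm' P x x' past close.
have inv_le : m'.+1%:R^-1 <= m.+1%:R^-1 :> R.
  by rewrite lef_pV2 ?posrE ?ltr0n // ler_nat.
apply: P.
  by move=> i im ri; apply: lt_le_trans (past i (leq_trans im mm') ri) inv_le.
exact: le_ball close.
Qed.

Lemma finitely_determined_predicts phi m :
  finitely_determined [set r : Ord G | predicts aX pi e phi m r].
Proof.
exists [seq (e i, 1%g) | i <- iota 0 m] => r r' rr' P x x' past close.
apply: P => // i im ri; apply: past => //.
by rewrite -(rr' (e i, 1%g)) // map_f // mem_iota.
Qed.

(** The events [P m] increase to one of full measure, so some [P m] has probability at least
    [1 - eta]. This [m] is chosen before [F]; only the order depends on [F]. *)
Lemma exists_predicted_order (nu : probability (borelOrd G) R) phi (eta : R) :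
  Ord_invariant nu -> predictable nu aX pi -> continuous phi -> 0 < eta ->
  exists m, forall F : {fset G}, exists r,
    (\sum_(g : F) ~~ `[< predicts aX pi e phi m (Ord_act (val g) r) >])%N%:R <=
    eta * #|` F|%:R.
Proof.
move=> inv pred phi_cont eta0.
pose P m : set (borelOrd G) := [set r | predicts aX pi e phi m r].
have mP m : measurable (P m).
  by apply: measurable_finitely_determined; exact: finitely_determined_predicts.
have mUP : measurable (\bigcup_m P m) by exact: bigcupT_measurable.
have nuUP : nu (\bigcup_m P m) = 1%E.
  have : nu (~` \bigcup_m P m) = 0%E.
    apply: measure_negligible; first exact: measurableC.
    have := pred phi phi_cont; apply: negligibleS => r nr /= sr; apply: nr.
    have det := predictable_determined aX_continuous pi_continuous phi_cont sr.
    have [m Pm] := determined_predicts X_compact aX_continuous pi_continuous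
      e_surj phi_cont det.
    by exists m.
  rewrite probability_setC // => h.
  have := h; rewrite -(@fineK _ (nu (\bigcup_m P m))) ?fin_num_measure //.
  by rewrite -EFinB => -[] /eqP; rewrite subr_eq0 => /eqP <-.
have : (nu \o P) @ \oo --> nu (\bigcup_m P m).
  apply: nondecreasing_cvg_mu => // m m' mm'; apply/subsetPset => r.
  exact: predicts_leq.
rewrite nuUP => /fine_cvgP[_ /cvgrPdist_lt/(_ eta eta0)[m _ /(_ m (leqnn m))]]
  /=.
move=> lt_eta; exists m => F.
have [||r Hr] := @exists_order_average R G nu (~` P m) eta F inv.
- exact/finitely_determinedC/finitely_determined_predicts.
- rewrite probability_setC // -(@fineK _ (nu (P m))) ?fin_num_measure //.
  by rewrite -EFinB lee_fin; apply: le_trans (ler_norm _) (ltW lt_eta).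
exists r; move: Hr; congr (_%:R <= _); apply: eq_bigr => g _.
by rewrite asbool_neg.
Qed.

End RandomPrediction.

(** * Choosing the windows *)

Section CoverableTheory.
Context {R : realType} {G : groupType} {X : Type}.
Variables (a : G -> X -> X) (U : set (set X)) (F : {fset G}).

Lemma coverable_sub (B B' : set X) (N N' : R) : B `<=` B' -> N' <= N ->
  coverable a U F B' N' -> coverable a U F B N.
Proof.
move=> BB' NN' [s [size_s small_s cov_s]]; exists s; split => //.
  exact: le_trans NN'.
by move=> x /BB' /cov_s.
Qed.

Lemma coverableU (B B' : set X) (N N' : R) :
  coverable a U F B N -> coverable a U F B' N' ->
  coverable a U F (B `|` B') (N + N').
Proof.
move=> [s [size_s small_s cov_s]] [s' [size_s' small_s' cov_s']].
exists (s ++ s'); split.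
- by rewrite size_cat natrD lerD.
- by move=> W; rewrite mem_cat => /orP[/small_s|/small_s'].
- move=> x [/cov_s|/cov_s'] [W Ws Wx]; exists W => //.
    by rewrite mem_cat Ws.
  by rewrite mem_cat Ws orbT.
Qed.

Lemma coverable0 (N : R) : 0 <= N -> coverable a U F set0 N.
Proof. by move=> N0; exists [::]; split. Qed.

End CoverableTheory.

(** * Almost invariance and size of Folner sets *)

Section Folner.
Context {R : realType} {G : groupType}.
Variable F : nat -> {fset G}.
Hypothesis folnerF : folner R F.

Lemma folner_card_gt0 n : (0 < #|` F n|)%N.
Proof. by rewrite cardfs_gt0; case: folnerF => /(_ n). Qed.

Lemma folner_translate (g : G) (eta : R) : 0 < eta ->
  \forall n \near \oo,
    (\sum_(h : F n) ((g * val h)%g \notin F n))%N%:R <= eta * #|` F n|%:R.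
Proof.
move=> eta0; have [_ /(_ g)] := folnerF.
move=> /cvgrPdist_le/(_ eta eta0); apply: filterS => n.
set gF := [fset (g * x)%g | x in F n]%fset.
rewrite sub0r normrN => /(le_trans (ler_norm _)).
rewrite ler_pdivrMr ?ltr0n ?folner_card_gt0 //; apply: le_trans.
rewrite ler_nat (@leq_trans #|` gF `\` F n|%fset) //; last first.
  by rewrite fsubset_leq_card // fsubsetUl.
pose S := [fset h in F n | (g * h)%g \notin F n]%fset.
have -> : (\sum_(h : F n) ((g * val h)%g \notin F n) = #|` S|)%N.
  rewrite card_fset_sum1 big_fset /= big_seq_fsetE /= [RHS]big_mkcond /=.
  by apply: eq_bigr => h _; case: ifP.
have <- : #|` [fset (g * x)%g | x in S]%fset| = #|` S|.
  by rewrite card_imfset //; exact: mulgI.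
apply: fsubset_leq_card; apply/fsubsetP => y /imfsetP[h /=].
rewrite !inE => /andP[hF nF] ->; rewrite nF andTb.
by apply/imfsetP; exists h.
Qed.

Lemma folner_translates (e : nat -> G) m (eta : R) : 0 < eta ->
  \forall n \near \oo,
    (\sum_(h : F n) ~~ `[< forall i, (i < m)%N -> (e i * val h)%g \in F n
      >])%N%:R
      <= eta * #|` F n|%:R.
Proof.
move=> eta0; pose d := eta / m.+1%:R.
have d0 : 0 < d by rewrite divr_gt0.
have : \forall n \near \oo, forall i : 'I_m,
    (\sum_(h : F n) ((e i * val h)%g \notin F n))%N%:R <= d * #|` F n|%:R.
  by apply: filter_forall => i; exact: folner_translate.
apply: filterS => n le_d.
apply: (@le_trans _ _ (\sum_(i < m) \sum_(h : F n) ((e i * val h)%g \notin F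
  n))%N%:R).
  rewrite ler_nat exchange_big /=; apply: leq_sum => h _.
  case: asboolP => //= nall; rewrite lt0n sum_nat_eq0;
    apply/negP => /forallP all0.
  apply: nall => i im; have := all0 (Ordinal im); rewrite /= eqb0.
  by rewrite negbK.
rewrite natr_sum; apply: (le_trans (ler_sum _ (fun i _ => le_d i))).
rewrite sumr_const card_ord -[leLHS]mulr_natl mulrA ler_wpM2r //.
by rewrite /d mulrCA ger_pMr // ler_pdivrMr // mul1r ler_nat.
Qed.

(** Take a finite [A] with at least [N] elements. If [#|F n| < N], fewer than one element of [F n]
    is moved out by each [g] in [A], hence none, and [F n] contains a right translate of [A]. *)
Lemma folner_infinite : infinite_set [set: G] -> forall N,
  \forall n \near \oo, (N <= #|` F n|)%N.
Proof.
move=> infG N; have [A _ cardA] := infinite_set_fset N infG.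
pose d : R := (N.+1%:R)^-1.
have d0 : 0 < d by rewrite invr_gt0.
have : \forall n \near \oo, forall g : A,
    (\sum_(h : F n) ((val g * val h)%g \notin F n))%N%:R <= d * #|` F n|%:R.
  by apply: filter_forall => i; exact: folner_translate.
apply: filterS => n le_d; rewrite leqNgt; apply/negP => ltN.
have inF (g : A) (h : F n) : (val g * val h)%g \in F n.
  apply: contraT => nin; suff : 1 <= (\sum_(h : F n) ((val g * val h)%g \notin
    F n))%N%:R :> R.
    move/le_trans/(_ (le_d g)); rewrite /d mulrC ler_pdivlMr // mul1r ler_nat.
    by move=> /leq_trans/(_ (ltnW ltN)); rewrite ltnn.
  by rewrite ler1n lt0n sum_nat_eq0; apply/negP => /forallP/(_ h) /=;
    rewrite nin.
have [h hF] : exists h, h \in F n.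
  by have := folner_card_gt0 n; rewrite cardfs_gt0 => /fset0Pn.
have : (#|` A| <= #|` F n|)%N.
  have <- : #|` [fset (x * h)%g | x in A]%fset| = #|` A|.
    by rewrite card_imfset //; exact: mulIg.
  apply: fsubset_leq_card; apply/fsubsetP => y /imfsetP[g /= gA ->].
  exact: (inF [` gA]%fset [` hF]%fset).
by move=> /(leq_trans cardA)/(leq_trans ltN); rewrite ltnn.
Qed.

End Folner.

(** * Slow growth and infinite branches of window choices *)

Section Growth.
Context {R : realType} {G : groupType} {X Y : metricType R}.
Variables (aX : G -> X -> X) (pi : X -> Y) (F : nat -> {fset G}).

Definition orbit_close (delta : R) (K : {fset G}) (D : set X) :=
  forall g x x', g \in K -> D x -> D x' ->
    ball (pi (aX g x)) delta (pi (aX g x')).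

(** The constant [C] makes the notion stable under finite unions without changing the exponent
    [kappa]. *)
Definition slow_growth (f : X -> R) (kappa : R) (B : nat -> set X) :=
  exists2 delta : R, 0 < delta & exists C : R, \forall n \near \oo,
    forall D, orbit_close delta (F n) D ->
      coverable aX (threshold_cover f) (F n) (D `&` B n)
        (C * expR (kappa * #|` F n|%:R)).

Lemma orbit_close_le delta delta' K D : delta <= delta' ->
  orbit_close delta K D -> orbit_close delta' K D.
Proof. by move=> dd' close g x x' gK Dx Dx'; apply: le_ball dd' _ _;
  exact: close. Qed.

Lemma slow_growth_bigcup f kappa (B : nat -> nat -> set X) k :
  (forall v, (v < k)%N -> slow_growth f kappa (B v)) ->
  slow_growth f kappa (fun n => \bigcup_(v < k) B v n).
Proof.
elim: k => [|k IH] slowB.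
  exists 1 => //; exists 0; apply: nearW => n D _.
  by rewrite bigcup_mkord big_ord0 setI0 mul0r; exact: coverable0.
have [d1 d1_gt0 [C1 near1]] := IH (fun v vk => slowB v (ltnW vk)).
have [d2 d2_gt0 [C2 near2]] := slowB k (ltnSn k).
exists (Num.min d1 d2); first by rewrite lt_min d1_gt0.
exists (C1 + C2); apply: filterS2 near1 near2 => n cov1 cov2 D close.
rewrite mulrDl bigcup_mkord big_ord_recr /= setIUr -(bigcup_mkord k (B ^~ n)).
apply: coverableU.
  by apply: cov1; apply: orbit_close_le close; rewrite ge_min lexx.
by apply: cov2; apply: orbit_close_le close; rewrite ge_min lexx orbT.
Qed.

Lemma slow_growth_sub f kappa (B B' : nat -> set X) :
  (\forall n \near \oo, B n `<=` B' n) ->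
  slow_growth f kappa B' -> slow_growth f kappa B.
Proof.
move=> BB' [d d0 [C cov]]; exists d => //; exists C.
apply: filterS2 BB' cov => n sub cov D /cov; apply: coverable_sub => //.
exact: setIS.
Qed.

Section Branching.
Variables (f : X -> R) (kappa eta : R) (M : nat -> nat).
Hypothesis eta_gt0 : 0 < eta.
Hypothesis M_large : forall k, 2 ^+ k.+1 / eta < (M k)%:R.
Hypothesis folnerF : folner R F.

Definition rarely_visits (k : nat) (c : nat -> nat) n : set X :=
  [set x | forall i, (i < k)%N -> (visits aX f M c (F n) i x)%:R <=
    eta * 2^-1 ^+ i.+1 * #|` F n|%:R].

Let upd (c : nat -> nat) k v j := if j == k then v else c j.

Let M_gt0 k : (0 < M k)%N.
Proof.
rewrite -(ltr_nat R); apply: le_lt_trans (M_large k).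
by rewrite divr_ge0 ?exprn_ge0 // ltW.
Qed.

Lemma visits_prefix c c' K i x :
  (forall l, (l <= i)%N -> c l = c' l) ->
  visits aX f M c K i x = visits aX f M c' K i x.
Proof.
move=> cc'; apply: eq_bigr => g _; congr nat_of_bool.
by apply: window_prefix => l li; rewrite add0n; apply: cc'.
Qed.

(** Pigeonhole: the [M k] candidate windows of depth [k.+1] are disjoint, so their visits add up to
    at most [#|F n|], and [M_large] forbids all of them from being visited often. *)
Lemma rarely_visits_split k c n : (forall j, (c j < M j)%N) ->
  rarely_visits k c n `<=`
    \bigcup_(v < M k) rarely_visits k.+1 (upd c k v) n.
Proof.
move=> c_lt x few; apply: contrapT => none.
have Fn0 := folner_card_gt0 folnerF n.
have many v : (v < M k)%N ->
    eta * 2^-1 ^+ k.+1 * #|` F n|%:R <= (visits aX f M (upd c k v) (F n) k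
      x)%:R.
  move=> vM; rewrite leNgt; apply/negP => lt; apply: none; exists v => // i.
  rewrite ltnS leq_eqVlt => /predU1P[->|ik]; first exact: ltW.
  rewrite (@visits_prefix _ c); first exact: few.
  by move=> l li; rewrite /upd; case: eqP => // lk;
    move: (leq_ltn_trans li ik); rewrite lk ltnn.
have : (\sum_(v < M k) visits aX f M (upd c k v) (F n) k x <= #|` F n|)%N.
  rewrite cardfE -sum1_card exchange_big /=; apply: leq_sum => g _.
  set t := f _.
  have [[v0 w0]|none0] := pselect (exists v : 'I_(M k), window M (upd c k v)
    k.+1 0 t); last first.
    by rewrite big1 // => v _; apply/eqP; rewrite eqb0; apply/negP => w;
      apply: none0; exists v.
  rewrite (bigD1 v0) //= big1 ?addn0 ?leq_b1 // => v vv0.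
  apply/eqP; rewrite eqb0.
  apply: (@window_disjoint R M (upd c k v0) (upd c k v) k 0 t) => //.
  - by move=> l; rewrite /upd; case: eqP => [->|].
  - by move=> l; rewrite /upd; case: eqP => [->|].
  - by move=> l lk; rewrite /upd add0n ltn_eqF.
  - by rewrite /upd add0n eqxx eq_sym.
rewrite -(ler_nat R) natr_sum => /(le_trans (ler_sum _ (fun v _ => many _
  (ltn_ord v)))).
rewrite sumr_const card_ord leNgt => /negP; apply.
rewrite -[ltRHS]mulr_natl mulrA ltr_pMl ?ltr0n //.
have := M_large k; rewrite ltr_pdivrMr // => lt; rewrite exprVn mulrA.
by rewrite ltr_pdivlMr ?exprn_gt0 // mul1r.
Qed.

Let step k (c : nat -> nat) : nat := xget 0%N [set v | (v < M k)%N /\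
  ~ slow_growth f kappa (rarely_visits k.+1 (upd c k v))].

Fixpoint branch k : nat -> nat :=
  if k is k'.+1 then upd (branch k') k' (step k' (branch k')) else fun=> 0%N.

(** As in the lemma of König: a finite union of slowly growing parts grows slowly, so failure is
    inherited by one of the finitely many choices at each level. *)
Lemma exists_branch : ~ slow_growth f kappa (fun=> setT) ->
  exists2 c : nat -> nat, forall j, (c j < M j)%N &
    forall k, ~ slow_growth f kappa (rarely_visits k c).
Proof.
move=> nslow.
have inv k : (forall j, (branch k j < M j)%N) /\
    ~ slow_growth f kappa (rarely_visits k (branch k)).
  elim: k => [|k [lt nslowk]] /=.
    split; first by move=> j; exact: M_gt0.
    move=> slow; apply: nslow; apply: slow_growth_sub slow.
    by apply: nearW => n x _ i.
  have [v vP] : exists v, (v < M k)%N /\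
      ~ slow_growth f kappa (rarely_visits k.+1 (upd (branch k) k v)).
    apply: contrapT => none; apply: nslowk.
    apply: (@slow_growth_sub _ _ _ (fun n => \bigcup_(v < M k)
        rarely_visits k.+1 (upd (branch k) k v) n)).
      by apply: nearW => n; exact: rarely_visits_split.
    apply: slow_growth_bigcup => v vM; apply: contrapT => ns.
    by apply: none; exists v.
  have [stepM step_slow] := xgetPex 0%N (ex_intro _ v vP : exists v, [set v |
    _] v).
  split => // j; rewrite /upd; case: eqP => // ->; exact: stepM.
(* Entry [j] is fixed at stage [j.+1] and kept afterwards, so this diagonal agrees with [branch k]
   below [k], which is all that [rarely_visits k] sees. *)
pose c j := branch j.+1 j.
have c_branch k j : (j < k)%N -> c j = branch k j.
  elim: k => // k IH; rewrite ltnS leq_eqVlt => /predU1P[->|jk]; first by [].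
  by rewrite IH //= /upd ltn_eqF.
exists c => [j|k]; first by have [lt _] := inv j.+1; exact: lt.
have [_ nslowk] := inv k; apply: contra_not nslowk; apply: slow_growth_sub.
apply: nearW => n x few i ik; rewrite (@visits_prefix _ (branch k));
  first exact: few.
by move=> l li; apply: c_branch; exact: leq_ltn_trans ik.
Qed.

End Branching.

End Growth.

Lemma compact_finite_subcover (T : topologicalType) (I : choiceType)
    (f : I -> set T) : compact [set: T] ->
  (forall x : T, exists i, nbhs x (f i)) ->
  exists S : {fset I}, forall x, exists2 i, i \in S & f i x.
Proof.
move=> T_compact f_cover.
(* Compactness is used in its near-covering form, along the filter of all sufficiently large finite
   sets of indices. *)
pose large := filter_from [set: {fset I}] (fun S => [set S' | S `<=` S']%fset).
have large_filter : Filter large.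
  apply: filter_fromT_filter; first by exists fset0.
  by move=> S S'; exists (S `|` S')%fset => S'' /=; rewrite fsubUset => /andP.
have := T_compact => /compact_near_coveringP/(_ {fset I} large
  (fun S x => exists2 i, i \in S & f i x) large_filter).
case=> [x _|S _ /(_ S (fsubset_refl S)) covS]; last by exists S => x;
  exact: covS.
have [i fi] := f_cover x.
exists (f i, [set S | [fset i]%fset `<=` S]%fset).
  by split => //; exists [fset i]%fset => // S.
by move=> [y S] /= [fy /fsubsetP iS]; exists i => //; apply: iS; rewrite inE.
Qed.

(** * Covers of zero entropy relative to the factor *)

Section Tame.
Context {R : realType} {G : groupType} {X Y : metricType R}.
Variables (aX : G -> X -> X) (pi : X -> Y) (F : nat -> {fset G}).
Variables (nu : probability (borelOrd G) R).
Hypothesis G_countable : countable [set: G].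
Hypothesis X_compact : compact [set: X].
Hypothesis aX_action : continuous_action aX.
Hypothesis pi_continuous : continuous pi.
Hypothesis nu_invariant : Ord_invariant nu.
Hypothesis nu_predictable : predictable nu aX pi.
Hypothesis folnerF : folner R F.

(** A uniform way of saying that [U] has zero entropy conditionally on [pi]. *)
Definition tame (U : set (set X)) := forall kappa : R, 0 < kappa ->
  exists2 delta : R, 0 < delta & \forall n \near \oo,
    forall D, orbit_close aX pi delta (F n) D ->
      coverable aX U (F n) D (expR (kappa * #|` F n|%:R)).

Let exists_enum : exists e : nat -> G, forall g, exists i, e i = g.
Proof.
have /countable_injP[e e_inj] := G_countable.
exists (fun i => xget 1%g [set g | e g = i]) => g; exists (e g).
apply: e_inj; rewrite ?inE //.
by have := @xgetPex _ 1%g [set h | e h = e g] (ex_intro _ g erefl).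
Qed.

Let aX_continuous g : continuous (aX g).
Proof. by have [_ _] := aX_action; exact. Qed.

Lemma slow_growth_setT (f : X -> R) (kappa : R) : continuous f -> 0 < kappa ->
  slow_growth aX pi F f kappa (fun=> setT).
Proof.
move=> f_cont kappa0; have [e e_surj] := exists_enum.
(* [L >= 8 / kappa] makes [4 * expR (- L)] at most [kappa / 2], and [eta] is chosen so that
   [L * (4 * eta)] is the other half. *)
pose L := Num.max 8 (8 / kappa).
have L8 : 8 <= L by rewrite le_max lexx.
have L0 : 0 < L by lra.
pose eta := kappa / (8 * L).
have eta0 : 0 < eta by rewrite divr_gt0 ?mulr_gt0.
have le_kappa : 4 * expR (- L) + L * (4 * eta) <= kappa.
  have -> : L * (4 * eta) = kappa / 2 by rewrite /eta; field; lra.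
  suff : expR (- L) <= kappa / 8 by lra.
  rewrite expRN -[leRHS]invrK lef_pV2 ?posrE ?invr_gt0 ?expR_gt0 ?divr_gt0 //
    invf_div.
  apply: (@le_trans _ _ L); first by rewrite le_max lexx orbT.
  by apply: le_trans (expR_ge1Dx L); lra.
pose M k := (Num.truncn (2 ^+ k.+1 / eta)).+1.
have M_large k : 2 ^+ k.+1 / eta < (M k)%:R by exact: truncnS_gt.
apply: contrapT => /(exists_branch eta0 M_large folnerF)[c c_lt].
pose phi x := stair_lim M c (f x).
have phi_cont : continuous phi.
  by move=> x; apply: continuous_comp; [exact: f_cont|exact:
    continuous_stair_lim].
have [m predm] := exists_predicted_order X_compact aX_continuous pi_continuous
  e_surj nu_invariant nu_predictable phi_cont eta0.
(* The branch was built before [m] is known. [coverable_branch] bounds the visits for all [i <= m],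
   so stage [m.+1] is the one contradicted. *)
move=> /(_ m.+1); apply.
exists (m.+1%:R^-1); first by rewrite invr_gt0.
exists 1; apply: filterS (folner_translates folnerF e m eta0) => n inF D close.
have [r predr] := predm (F n); rewrite mul1r.
apply: (@coverable_branch R G X Y aX pi e f M c c_lt _ r (F n) m eta L) => //.
- by have [_ ? _] := aX_action.
- exact: ltW.
(* One [eta] pays for failed predictions, the other for the [g] with some [e i * g], [i < m],
   outside [F n]. *)
- rewrite -mulrA mulr2n mulrDl mul1r; apply: le_trans (lerD predr inF).
  rewrite -natrD ler_nat -big_split /=; apply: leq_sum => g _.
  rewrite asbool_and; by case: asbool; case: asbool.
Qed.

Lemma tame_threshold (f : X -> R) : continuous f -> tame (threshold_cover f).
Proof.
move=> f_cont kappa kappa0.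
(* For infinite [G], [#|F n|] tends to infinity and half of the exponent absorbs [C]. For finite [G]
   a minimal element of the order is used instead. *)
have [finG|infG] := pselect (finite_set [set: G]); last first.
  have [delta delta0 [C slow]] := slow_growth_setT f_cont (divr_gt0 kappa0
    (ltr0n R 2)).
  exists delta => //.
  have := folner_infinite folnerF infG (Num.truncn (C / (kappa / 2))).+1.
  apply: filterS2 slow => n slow large D /slow;
    apply: coverable_sub => [x Dx|]; first by split.
  have -> : kappa * #|` F n|%:R = kappa / 2 * #|` F n|%:R + kappa / 2 * #|` F
    n|%:R by lra.
  rewrite expRD ler_pM2r ?expR_gt0 //.
  apply: le_trans (expR_ge1Dx _).
  have : C / (kappa / 2) <= #|` F n|%:R.
    by apply: le_trans (ltW (truncnS_gt _)) _; rewrite ler_nat.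
  by rewrite ler_pdivrMr ?divr_gt0 // => /le_trans; apply; rewrite mulrC lerDr.
have [e e_surj] := exists_enum.
have [A Aall] : exists A : {fset G}, forall g, g \in A.
  by have /finite_fsetP[A AT] := finG; exists A => g; have : [set: G] g by [];
    rewrite AT.
have A0 : (0 < #|` A|)%N by rewrite cardfs_gt0; apply/fset0Pn; exists 1%g.
(* With this [eta] the number of failures in [A] is at most [1/2], hence zero. *)
have eta0 : 0 < (2 * #|` A|%:R)^-1 :> R by rewrite invr_gt0 mulr_gt0 ?ltr0n.
have [m predm] := exists_predicted_order X_compact aX_continuous pi_continuous
  e_surj nu_invariant nu_predictable f_cont eta0.
have [r predr] := predm A.
have pred_all g : predicts aX pi e f m (Ord_act g r).
  apply: contrapT => npred; move: predr; rewrite (bigD1 [` Aall g]%fset) //=.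
  rewrite asboolF //= natrD => h.
  have : (2 * #|` A|%:R)^-1 * #|` A|%:R = 2^-1 :> R by field;
    rewrite pnatr_eq0 -lt0n.
  move: h => /[swap] ->; rewrite leNgt => /negP; apply.
  by apply: (@lt_le_trans _ _ 1); [lra | rewrite lerDl ler0n].
have [g gmin] : exists g, forall h, ~~ prec r h g.
  apply: (@prec_ind G r A (fun=> exists g, forall h, ~~ prec r h g) _ 1%g) =>
    // g _ IH.
  have [[h hg]|none] := pselect (exists h, prec r h g); first exact: (IH h).
  by exists g => h; apply/negP => hg; apply: none; exists h.
exists (m.+1%:R^-1); first by rewrite invr_gt0.
apply: nearW => n D close; exists [:: D]; split => //; last by move=> x Dx;
  exists D; rewrite ?inE.
  by rewrite -expR0 ler_expR mulr_ge0 // ltW.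
move=> W; rewrite inE => /eqP -> h hF.
have [[x Dx f0]|f0] := pselect (exists2 x, D x & f (aX h x) <= 0); last first.
  exists [set x | 0 < f x]; first by left.
  by move=> x Dx /=; rewrite ltNge; apply/negP => ?; apply: f0; exists x.
exists [set x | f x < 1]; first by right.
move=> x' Dx' /=.
(* After translation by the minimal [g], nothing precedes [1]: the past is empty, and closeness in
   [Y] alone controls [f] up to [1/2]. *)
have := pred_all g (aX h x) (aX h x'); rewrite ltr_norml.
suff H : forall i, (i < m)%N -> prec (Ord_act g r) (e i) 1%g ->
    `|f (aX (e i) (aX h x)) - f (aX (e i) (aX h x'))| < m.+1%:R^-1.
  by move=> /(_ H (close h x x' hF Dx Dx'))/andP[? ?]; lra.
by move=> i _; rewrite /prec /= mul1g => /(negP (gmin _)).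
Qed.

Lemma tame_refine (U V : set (set X)) :
  (forall A, U A -> exists2 B, V B & A `<=` B) -> tame U -> tame V.
Proof.
move=> UV tU kappa kappa0; have [delta delta0 cov] := tU kappa kappa0.
exists delta => //; apply: filterS cov => n cov D /cov[s [size_s small_s
  cov_s]].
exists s; split => // W /small_s small g /small[A /UV[B VB AB] WA].
by exists B => // x /WA /AB.
Qed.

Lemma tameI (U V : set (set X)) : tame U -> tame V ->
  tame [set A `&` B | A in U & B in V].
Proof.
move=> tU tV kappa kappa0; have k2 : 0 < kappa / 2 by lra.
have [d1 d10 cov1] := tU _ k2; have [d2 d20 cov2] := tV _ k2.
exists (Num.min d1 d2); first by rewrite lt_min d10.
apply: filterS2 cov1 cov2 => n cov1 cov2 D close.
have [|s [size_s small_s cov_s]] := cov1 D.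
  by apply: orbit_close_le close; rewrite ge_min lexx.
have [|s' [size_s' small_s' cov_s']] := cov2 D.
  by apply: orbit_close_le close; rewrite ge_min lexx orbT.
exists [seq W `&` W' | W <- s, W' <- s']; split.
- rewrite size_allpairs natrM.
  have -> : kappa * #|` F n|%:R = kappa / 2 * #|` F n|%:R + kappa / 2 * #|` F
    n|%:R by lra.
  by rewrite expRD ler_pM.
- move=> _ /allpairsP[[W W'] /= [Ws W's' ->]] g gF.
  have [A UA WA] := small_s W Ws g gF; have [B VB W'B] := small_s' W' W's' g gF.
  exists (A `&` B); first by exists A => //; exists B.
  by move=> x [/WA ? /W'B].
- move=> x Dx; have [W Ws Wx] := cov_s x Dx; have [W' W's' W'x] := cov_s' x Dx.
  by exists (W `&` W') => //; apply/allpairsP; exists (W, W').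
Qed.

Lemma tame_setT : tame [set setT].
Proof.
move=> kappa kappa0; exists 1 => //; apply: nearW => n D _; exists [:: setT];
  split.
- by rewrite -expR0 ler_expR mulr_ge0 // ltW.
- by move=> W; rewrite inE => /eqP -> g _; exists setT.
- by move=> x _; exists setT => //; rewrite inE.
Qed.

Lemma continuous_mdist (x : X) : continuous (fun y : X => mdist x y : R).
Proof.
move=> y; apply/cvgrPdist_lt => eps eps0.
have : \forall z \near y, ball y eps z by exact: nbhsx_ballx.
apply: filterS => z; rewrite ballEmdist /= => yz.
have := metric_triangle x y z; have := metric_triangle x z y.
rewrite [mdist z y]metric_sym => ? ?.
by rewrite ltr_norml; apply/andP; split; lra.
Qed.

(** Scaled so that [bump p < 1] is the ball of radius [p.2] about [p.1], while [bump p > 0] keeps at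
    distance more than [p.2 / 2] from [p.1]. *)
Let bump (p : X * R) (y : X) : R := 2 / p.2 * mdist p.1 y - 1.

Let bump_cover (s : seq (X * R)) : set (set X) :=
  foldr (fun p U => [set A `&` B | A in threshold_cover (bump p) & B in U])
    [set setT] s.

Let tame_bump_cover s : tame (bump_cover s).
Proof.
elim: s => [|p s IH] /=; first exact: tame_setT.
apply: tameI IH; apply: tame_threshold => y.
apply: cvgB; last exact: cvg_cst.
by apply: cvgMr; exact: continuous_mdist.
Qed.

Let bump_coverP s A : (forall p, p \in s -> 0 < p.2) -> bump_cover s A ->
  (exists2 p, p \in s & A `<=` ball p.1 p.2) \/
  (forall p, p \in s -> forall y, A y -> ~ ball p.1 (p.2 / 2) y).
Proof.
elim: s A => [|p s IH] A s0 /=; first by move=> _; right.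
move=> [B [-> | ->] [C covC <-]].
  have s0' q : q \in s -> 0 < q.2 by move=> qs; apply: s0; rewrite inE qs orbT.
  have [[q qs Cq]|none] := IH C s0' covC.
  - by left; exists q; [rewrite inE qs orbT|move=> y [_ /Cq]].
  right => q; rewrite inE => /predU1P[->|qs] y [/= By Cy]; last exact: none.
  have p0 : 0 < p.2 by apply: s0; rewrite inE eqxx.
  move: By; rewrite /bump subr_gt0 ballEmdist /= mulrAC ltr_pdivlMr // mul1r.
  by move=> ? ?; lra.
left; exists p; first by rewrite inE eqxx.
have p0 : 0 < p.2 by apply: s0; rewrite inE eqxx.
move=> y [/= By _]; move: By; rewrite /bump ltrBlDr ballEmdist /= mulrAC.
by rewrite ltr_pdivrMr // => ?; lra.
Qed.

(** Finitely many half-radius balls cover [X], so a member of the bump cover avoiding all of them is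
    empty; any other lies in a full-radius ball, hence in a member of [U]. *)
Lemma tame_open_cover (U : set (set X)) : open_cover U -> tame U.
Proof.
move=> [openU covU].
have [[x0 _]|X0] := pselect (exists x : X, True); last first.
  move=> kappa kappa0; exists 1 => //; apply: nearW => n D _; exists [::];
    split => //.
    exact: expR_ge0.
  by move=> x; exfalso; apply: X0; exists x.
have [U0 UU0] : exists A, U A.
  by have : [set: X] x0 by []; rewrite -covU => -[A UA _]; exists A.
have radius (x : X) : exists r : R, 0 < r /\ exists2 A, U A & ball x r `<=` A.
  have : [set: X] x by []; rewrite -covU => -[A UA Ax].
  have : nbhs x A by apply: open_nbhs_nbhs; split => //; exact: openU.
  by move=> /nbhs_ballP[r /= r0 rA]; exists r; split => //; exists A.
have [rad radP] := choice radius.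
have rad0 x : 0 < rad x by case: (radP x).
have [T covT] := @compact_finite_subcover _ X (fun y => ball y (rad y / 2))
  X_compact (fun x => ex_intro _ x (nbhsx_ballx x _ (divr_gt0 (rad0 x) (ltr0n R
    2)))).
pose s := [seq (x, rad x) | x <- enum_fset T].
apply: (tame_refine _ (tame_bump_cover s)) => A /bump_coverP[].
- by move=> _ /mapP[x _ ->]; exact: rad0.
- by move=> [_ /mapP[x _ ->] /= Ax]; have [_ [B UB xB]] := radP x;
  exists B => // y /Ax /xB.
- move=> none; exists U0 => // y Ay; have [x xT xy] := covT y; exfalso.
  by apply: (none (x, rad x)) Ay xy; apply: map_f.
Qed.

End Tame.

(** * Entropy *)

Section CoveringNumber.
Context {T : topologicalType}.
Implicit Types (U : set (set T)) (s : seq (set T)).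

Lemma has_subcover_fset U n : has_subcover U n <-> exists S : {fset set T},
  [/\ [set` S] `<=` U, #|` S| = n & forall x, exists2 A, A \in S & A x].
Proof.
split=> [[V [VU cardV covV]]|[S [SU cardS covS]]].
  have finV : finite_set V by apply/finite_setP; exists n.
  exists (fset_set V); rewrite fset_setK //; split => //.
    exact: card_fset_set.
  move=> x; have : [set: T] x by [].
  by rewrite -covV => -[A VA Ax]; exists A => //; rewrite in_fset_set ?inE.
exists [set` S]; split => //; first exact/card_eq_fsetP.
apply/seteqP; split => // x _; have [A AS Ax] := covS x.
by exists A.
Qed.

(** The cover [s] need only refine [U]: enlarging each of its sets to a member of [U] does not
    increase their number. *)
Lemma covering_number_le U s :
  (forall W, W \in s -> exists2 A, U A & W `<=` A) ->
  (forall x, exists2 W, W \in s & W x) ->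
  (covering_number U <= size s)%N.
Proof.
move=> sU cov_s.
have [sup supP] : exists sup : set T -> set T,
    forall W, W \in s -> U (sup W) /\ W `<=` sup W.
  have /choice[sup supP] : forall W, exists A, W \in s -> U A /\ W `<=` A.
    move=> W; have [Ws|nWs] := boolP (W \in s); last by exists set0.
    by have [A UA WA] := sU W Ws; exists A.
  by exists sup.
have : has_subcover U #|` [fset sup W | W in s]%fset|.
  apply/has_subcover_fset; exists [fset sup W | W in s]%fset; split => //.
    by move=> _ /imfsetP[W /= /supP[UW _] ->].
  move=> x; have [W Ws Wx] := cov_s x; exists (sup W); first exact: in_imfset.
  by have [_] := supP W Ws; exact.
set n := #|` _| => sub_n.
have le_n : (n <= size s)%N.
  by apply: leq_trans (size_undup s); rewrite /n; exact: leq_imfset_card.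
rewrite /covering_number; case: xgetP => [k _ [_ kmin]|_] //.
exact: leq_trans (kmin _ sub_n) le_n.
Qed.

Lemma covering_number_subcover U : compact [set: T] ->
  (forall x : T, exists2 A, U A & nbhs x A) ->
  exists s, [/\ size s = covering_number U, forall W, W \in s -> U W &
    forall x, exists2 W, W \in s & W x].
Proof.
move=> T_compact covU.
have [x|S covS] := @compact_finite_subcover T (set T)
    (fun A => [set x | U A /\ A x]) T_compact.
  have [A UA xA] := covU x; exists A; apply: filterS xA => y Ay; by split.
have ex_sub : exists n, `[< has_subcover U n >].
  exists #|` [fset A in S | `[< U A >]]%fset|; apply/asboolP/has_subcover_fset.
  exists [fset A in S | `[< U A >]]%fset; split => //.
    by move=> A; rewrite /= !inE => /andP[_ /asboolP].
  move=> x; have [A AS [UA Ax]] := covS x; exists A => //.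
  by rewrite !inE AS; apply/asboolP.
have : has_subcover U (covering_number U).
  rewrite /covering_number; case: xgetP => [k _ []|/(_ (ex_minn ex_sub))] //.
  case: ex_minnP => n /asboolP sub_n nmin nope; exfalso; apply: nope;
    split => // m sub_m.
  by apply: nmin; apply/asboolP.
move=> /has_subcover_fset[S' [S'U cardS' covS']].
by exists (enum_fset S'); split.
Qed.

End CoveringNumber.

Section JoinCover.
Context {G : groupType} {T : topologicalType}.
Variable a : G -> T -> T.

Lemma join_cover_nbhs (U : set (set T)) (K : {fset G}) :
  (forall g, continuous (a g)) -> open_cover U ->
  forall x : T, exists2 A, join_cover a U K A & nbhs x A.
Proof.
move=> a_cont [openU covU] x.
have /choice[u uP] : forall g, exists A, U A /\ A (a g x).
  move=> g; have : [set: T] (a g x) by [].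
  by rewrite -covU => -[A UA Ax]; exists A.
exists (\bigcap_(g in [set` K]) (a g @^-1` u g)).
  by exists u => // g _; case: (uP g).
apply: filter_bigI => g _; apply: a_cont.
have [Ug ugx] := uP g; apply: open_nbhs_nbhs; split => //; exact: openU.
Qed.

Lemma small_along_join_cover (U : set (set T)) (K : {fset G}) W :
  small_along a U K W -> exists2 A, join_cover a U K A & W `<=` A.
Proof.
move=> small.
have /choice[u uP] : forall g, exists A, g \in K -> U A /\ forall x, W x -> A
  (a g x).
  move=> g; have [gK|ngK] := boolP (g \in K); last by exists set0.
  by have [A UA WA] := small g gK; exists A.
exists (\bigcap_(g in [set` K]) (a g @^-1` u g)).
  by exists u => // g /uP[].
by move=> x Wx g /= /uP[_]; exact.
Qed.

End JoinCover.

Lemma limn_esup_le_shift {R : realType} (u v : (\bar R)^nat) (k : R) :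
  (\forall n \near \oo, (u n <= v n + k%:E)%E) ->
  (limn_esup u <= limn_esup v + k%:E)%E.
Proof.
move=> uv; rewrite -leeBlDr //; apply: le_ereal_inf_tmp => _ [V /= nearV <-].
rewrite EFinN leeBlDr //.
apply: (@le_trans _ _ (ereal_sup (u @` (V `&` [set n | (u n <= v n +
  k%:E)%E])))).
  apply: ereal_inf_lbound; exists (V `&` [set n | (u n <= v n + k%:E)%E]) => //.
  exact: filterI.
apply: ge_ereal_sup => _ [n [Vn uvn] <-]; apply: (le_trans uvn).
by rewrite leeD2r //; apply: ereal_sup_ubound; exists n.
Qed.

Lemma ler_ln_nat {R : realType} (n p : nat) (k : R) : 0 <= k ->
  n%:R <= p%:R * expR k -> ln n%:R <= ln p%:R + k.
Proof.
move=> k0 le_np.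
have ln_ge0 (q : nat) : 0 <= ln (q%:R : R).
  by case: q => [|q]; [rewrite ln0|apply: ln_ge0; rewrite ler1n].
(* The convention [ln 0 = 0] covers this case. *)
have [n0|n0] := posnP n; first by rewrite n0 ln0 // addr_ge0.
have p0 : (0 < p)%N.
  rewrite lt0n; apply/negP => /eqP p0; move: le_np.
  by rewrite p0 mul0r lern0 => /eqP n00; rewrite n00 in n0.
rewrite -[X in _ + X]expRK -lnM ?posrE ?expR_gt0 ?ltr0n //.
by rewrite ler_ln ?posrE ?mulr_gt0 ?expR_gt0 ?ltr0n.
Qed.

Lemma cover_entropy_le_shift {R : realType} {G : groupType}
    {S T : topologicalType} (a : G -> S -> S) (b : G -> T -> T)
    (F : nat -> {fset G}) (U : set (set S)) (V : set (set T)) (kappa : R) :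
  folner R F -> 0 <= kappa ->
  (\forall n \near \oo, (covering_number (join_cover a U (F n)))%:R <=
    (covering_number (join_cover b V (F n)))%:R * expR (kappa * #|` F n|%:R)) ->
  (cover_entropy R a F U <= cover_entropy R b F V + kappa%:E)%E.
Proof.
move=> folnerF kappa0 le_cov.
apply: limn_esup_le_shift; apply: filterS le_cov => n le_cov.
have Fn0 : 0 < #|` F n|%:R :> R by rewrite ltr0n (folner_card_gt0 folnerF).
rewrite -EFinD lee_fin ler_pdivrMr // mulrDl divfK ?gt_eqF //.
by apply: ler_ln_nat => //; rewrite mulr_ge0.
Qed.

(** * Comparing the entropies of the two actions *)

Section EntropyComparison.
Context {R : realType} {G : groupType} {X Y : metricType R}.
Variables (aX : G -> X -> X) (aY : G -> Y -> Y) (pi : X -> Y).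
Variables (F : nat -> {fset G}).
Hypothesis X_compact : compact [set: X].
Hypothesis Y_compact : compact [set: Y].
Hypothesis aX_continuous : forall g, continuous (aX g).
Hypothesis aY_continuous : forall g, continuous (aY g).
Hypothesis pi_continuous : continuous pi.
Hypothesis pi_surjective : forall y, exists x, pi x = y.
Hypothesis pi_equivariant : forall g x, pi (aX g x) = aY g (pi x).
Hypothesis folnerF : folner R F.

Lemma factor_entropy_le :
  (topological_entropy R aY F <= topological_entropy R aX F)%E.
Proof.
apply: ge_ereal_sup => _ [V covV <-]; have [openV coverV] := covV.
pose U := [set pi @^-1` B | B in V].
have covU : open_cover U.
  split; first by move=> _ [B VB <-]; move/continuousP: pi_continuous; apply;
    exact: openV.
  apply/seteqP; split => // x _.
  have : [set: Y] (pi x) by []; rewrite -coverV => -[B VB Bx].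
  by exists (pi @^-1` B) => //; exists B.
apply: (@le_trans _ _ (cover_entropy R aX F U)); last first.
  by apply: ereal_sup_ubound; exists U.
rewrite -[leRHS]adde0; apply: cover_entropy_le_shift => //.
apply: nearW => n; rewrite mul0r expR0 mulr1 ler_nat.
have [s [<- s_sub cov_s]] := covering_number_subcover X_compact
  (join_cover_nbhs (F n) aX_continuous covU).
(* By surjectivity the images under [pi] of a subcover of [X] cover [Y], and by equivariance they
   refine the join of [V]. *)
rewrite -(size_map (image^~ pi)); apply: covering_number_le.
  move=> _ /mapP[W /s_sub[u uU <-] ->]; apply: small_along_join_cover => g gF.
  have [B VB eB] := uU g gF; exists B => // _ [x /(_ g gF) /= Wx <-].
  by rewrite -pi_equivariant; move: Wx; rewrite -eB.
move=> y; have [x <-] := pi_surjective y; have [W Ws Wx] := cov_s x.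
by exists (pi @` W); [exact: map_f|exists x].
Qed.

Lemma tame_entropy_le :
  (forall U, open_cover U -> tame aX pi F U) ->
  (topological_entropy R aX F <= topological_entropy R aY F)%E.
Proof.
move=> tameX; apply: ge_ereal_sup => _ [U covU <-].
apply/lee_addgt0Pr => kappa kappa0.
have [delta delta0 cov] := tameX U covU kappa kappa0.
(* With radius [delta / 2], the preimage of a member of the join of [V] satisfies [orbit_close] for
   [delta], so it splits into at most [expR (kappa * #|F n|)] pieces small along [F n]. *)
pose V := [set (ball y (delta / 2))^° | y in [set: Y]].
have covV : open_cover V.
  split; first by move=> _ [y _ <-]; exact: open_interior.
  apply/seteqP; split => // y _; exists ((ball y (delta / 2))^°);
    first by exists y.
  by apply: nbhsx_ballx; rewrite divr_gt0.
apply: (@le_trans _ _ (cover_entropy R aY F V + kappa%:E)%E); last first.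
  by rewrite leeD2r //; apply: ereal_sup_ubound; exists V.
apply: cover_entropy_le_shift => //; first exact: ltW.
apply: filterS cov => n cov.
have [s [size_s s_sub cov_s]] := covering_number_subcover Y_compact
  (join_cover_nbhs (F n) aY_continuous covV).
have /choice[t tP] : forall W, exists t : seq (set X), W \in s ->
    [/\ (size t)%:R <= expR (kappa * #|` F n|%:R),
      forall A, A \in t -> small_along aX U (F n) A &
      forall x, W (pi x) -> exists2 A, A \in t & A x].
  move=> W; have [Ws|nWs] := boolP (W \in s); last by exists [::].
  have [|t tP] := cov (pi @^-1` W); last by exists t.
  move=> g x x' gF /= Wx Wx'.
  have [v vV eW] := s_sub W Ws; move: Wx Wx';
    rewrite -eW => /(_ g gF) /= + /(_ g gF) /=.
  have [y _ <-] := vV g gF; rewrite !pi_equivariant.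
  move=> /interior_subset + /interior_subset.
  exact: ball_splitr.
rewrite -size_s; pose tt := flatten [seq t W | W <- s].
apply: (@le_trans _ _ (size tt)%:R).
  rewrite ler_nat; apply: covering_number_le.
    move=> A /flattenP[_ /mapP[W Ws ->]] At; apply: small_along_join_cover.
    by have [_ small _] := tP W Ws; exact: small.
  move=> x; have [W Ws Wx] := cov_s (pi x); have [_ _ covW] := tP W Ws.
  have [A At Ax] := covW x Wx; exists A => //; apply/flattenP.
  by exists (t W) => //; exact: map_f.
rewrite size_flatten /shape -map_comp sumnE big_map natr_sum big_seq.
apply: (@le_trans _ _ (\sum_(W <- s | W \in s) expR (kappa * #|` F n|%:R))).
  by apply: ler_sum => W /tP[].
by rewrite -big_seq big_const_seq count_predT iter_addr_0 mulr_natl.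
Qed.

End EntropyComparison.

Theorem theorem0p2 (R : realType) (G : groupType)
    (X Y : metricType R) (aX : G -> X -> X) (aY : G -> Y -> Y) (pi : X -> Y)
    (G_countable : countable [set: G])
    (G_amenable : amenable R G)
    (X_compact : compact [set: X])
    (Y_compact : compact [set: Y])
    (aX_action : continuous_action aX)
    (aY_action : continuous_action aY)
    (pi_continuous : continuous pi)
    (pi_surjective : forall y, exists x, pi x = y)
    (pi_equivariant : forall g x, pi (aX g x) = aY g (pi x))
    (nu_exists : exists nu : probability (borelOrd G) R,
        Ord_invariant nu /\ predictable nu aX pi) :
  forall F : nat -> {fset G}, folner R F ->
    topological_entropy R aX F = topological_entropy R aY F.
Proof.
move=> F folnerF; have [nu [nu_invariant nu_predictable]] := nu_exists.
have [_ _ aX_continuous] := aX_action; have [_ _ aY_continuous] := aY_action.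
apply/eqP; rewrite eq_le; apply/andP; split; last exact: factor_entropy_le.
apply: tame_entropy_le => // U covU.
exact: (tame_open_cover G_countable X_compact aX_action pi_continuous
  nu_invariant nu_predictable folnerF covU).
Qed.
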